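(* The Fault-Tolerant Flow problem admits a polynomial-time $(\ell+1)$-factor approximation algorithm.
   Context: Fault-Tolerant Flow (FTF): given a directed graph $D=(V,A)$ with non-negative arc weights, two vertices $s,t\in V$, a set $M\subseteq A$ of vulnerable arcs and an integer $\ell\geq 1$, find a minimum-weight set $S\subseteq A$ such that for every $f\in M$, the set $S\setminus\{f\}$ contains $\ell$ arc-disjoint $s$-$t$ paths. *)

(* Defs.v *)
From HB Require Import structures.
From mathcomp Require Import all_boot all_order all_algebra.

Set Implicit Arguments.
Unset Strict Implicit.
Unset Printing Implicit Defensive.

Import Order.TTheory GRing.Theory Num.Theory.

(* Model of computation: the WHILE language of N. D. Jones ("Computability and
   Complexity from a Programming Perspective") over binary trees.  Unlike in
   its unit-cost semantics, evaluating an expression costs the total size of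
   the values of all its subexpressions, so that a run of cost k is simulated
   by a multitape Turing machine in time polynomial in k and the input size,
   and conversely: polynomial time here is the usual polynomial time, for
   functions as well as for decision problems. *)

Inductive tree := Leaf | Node of tree & tree.

Fixpoint tree_size (d : tree) : nat :=
  if d is Node l r then (tree_size l + tree_size r).+1 else 1%N.

Fixpoint tree_eqb (d e : tree) : bool :=
  match d, e with
  | Leaf, Leaf => true
  | Node d1 d2, Node e1 e2 => tree_eqb d1 e1 && tree_eqb d2 e2
  | _, _ => false
  end.

Definition tree_of_bool (b : bool) : tree := if b then Node Leaf Leaf else Leaf.

Definition is_node (d : tree) : bool := if d is Node _ _ then true else false.

Inductive expr :=
  | EVar of nat
  | ENil
  | ECons of expr & expr
  | EHd of expr
  | ETl of expr
  | EEq of expr & expr.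

Inductive cmd :=
  | CSkip
  | CAssign of nat & expr
  | CSeq of cmd & cmd
  | CIf of expr & cmd & cmd
  | CWhile of expr & cmd.

Definition store := nat -> tree.

Definition upd (st : store) (x : nat) (d : tree) : store :=
  fun y => if y == x then d else st y.

Fixpoint eval (st : store) (e : expr) : tree :=
  match e with
  | EVar x => st x
  | ENil => Leaf
  | ECons e1 e2 => Node (eval st e1) (eval st e2)
  | EHd e1 => if eval st e1 is Node l _ then l else Leaf
  | ETl e1 => if eval st e1 is Node _ r then r else Leaf
  | EEq e1 e2 => tree_of_bool (tree_eqb (eval st e1) (eval st e2))
  end.

Fixpoint ecost (st : store) (e : expr) : nat :=
  (tree_size (eval st e) +
   match e with
   | EVar _ | ENil => 0
   | EHd e1 | ETl e1 => ecost st e1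
   | ECons e1 e2 | EEq e1 e2 => ecost st e1 + ecost st e2
   end)%N.

(* [exec c st k st'] : started in [st], [c] halts in [st'], at cost [k]. *)
Inductive exec : cmd -> store -> nat -> store -> Prop :=
  | exec_skip st : exec CSkip st 1 st
  | exec_assign st x e :
      exec (CAssign x e) st (ecost st e).+1 (upd st x (eval st e))
  | exec_seq c1 c2 st1 st2 st3 k1 k2 :
      exec c1 st1 k1 st2 -> exec c2 st2 k2 st3 ->
      exec (CSeq c1 c2) st1 (k1 + k2) st3
  | exec_if_true e c1 c2 st st' k :
      is_node (eval st e) -> exec c1 st k st' ->
      exec (CIf e c1 c2) st (ecost st e + k).+1 st'
  | exec_if_false e c1 c2 st st' k :
      ~~ is_node (eval st e) -> exec c2 st k st' ->
      exec (CIf e c1 c2) st (ecost st e + k).+1 st'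
  | exec_while_false e c st :
      ~~ is_node (eval st e) -> exec (CWhile e c) st (ecost st e).+1 st
  | exec_while_true e c st1 st2 st3 k1 k2 :
      is_node (eval st1 e) -> exec c st1 k1 st2 ->
      exec (CWhile e c) st2 k2 st3 ->
      exec (CWhile e c) st1 (ecost st1 e + k1 + k2).+1 st3.

(* Variable 0 holds the input at the start and the output at the end. *)
Definition runs (c : cmd) (d : tree) (k : nat) (d' : tree) : Prop :=
  exists2 st, exec c (upd (fun=> Leaf) 0 d) k st & st 0%N = d'.

Local Open Scope ring_scope.

Definition polytime (I : Type) (O : I -> Type) (encI : I -> tree)
    (encO : forall i, O i -> tree) (f : forall i, O i) : Prop :=
  exists (c : cmd) (p : {poly nat}), forall i : I,
    exists2 k, runs c (encI i) k (encO i (f i)) & (k <= p.[tree_size (encI i)])%N.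

Definition enc_seq (s : seq tree) : tree := foldr Node Leaf s.

(* Binary notation, least significant bit first. *)
Fixpoint enc_pos (p : BinNums.positive) : tree :=
  match p with
  | BinNums.xH => Node (tree_of_bool true) Leaf
  | BinNums.xO q => Node (tree_of_bool false) (enc_pos q)
  | BinNums.xI q => Node (tree_of_bool true) (enc_pos q)
  end.

Definition enc_nat (n : nat) : tree :=
  if bin_of_nat n is BinNums.Npos p then enc_pos p else Leaf.

(* Only used on nonnegative rationals, hence no sign. *)
Definition enc_rat (q : rat) : tree :=
  Node (enc_nat `|numq q|%N) (enc_nat `|denq q|%N).

(* Parallel arcs and loops are allowed. *)
Record ftf_instance := FTFInstance {
  nvert : nat;
  narc : nat;
  arc_tail : 'I_narc -> 'I_nvert;
  arc_head : 'I_narc -> 'I_nvert;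
  weight : 'I_narc -> rat;
  source : 'I_nvert;
  target : 'I_nvert;
  vulnerable : {set 'I_narc};
  ell : nat;
  weight_ge0 : forall a, 0 <= weight a;
  ell_ge1 : (1 <= ell)%N
}.

Notation vertex I := 'I_(nvert I).
Notation darc I := 'I_(narc I).

Section FaultTolerantFlow.
Variable I : ftf_instance.
Implicit Types (x y : vertex I) (a f : darc I) (S : {set darc I}).

Fixpoint diwalk x (p : seq (darc I)) y : bool :=
  if p is a :: p' then (arc_tail a == x) && diwalk (arc_head a) p' y else x == y.

Definition dipath x (p : seq (darc I)) y : bool :=
  diwalk x p y && uniq (x :: [seq arc_head a | a <- p]).

Definition has_disjoint_paths (k : nat) x y S : Prop :=
  exists P : 'I_k -> seq (darc I),
    (forall i, dipath x (P i) y /\ {subset P i <= S}) /\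
    (forall i j, i != j -> forall a, ~~ ((a \in P i) && (a \in P j))).

Definition feasible S : Prop :=
  forall f, f \in vulnerable I ->
    has_disjoint_paths (ell I) (source I) (target I) (S :\ f).

Definition total_weight S : rat := \sum_(a in S) weight a.

Definition enc_arc a : tree :=
  enc_seq [:: enc_nat (arc_tail a); enc_nat (arc_head a); enc_rat (weight a);
              tree_of_bool (a \in vulnerable I)].

Definition enc_instance : tree :=
  enc_seq [:: enc_seq [seq enc_nat x | x : vertex I <- enum 'I_(nvert I)];
              enc_seq [seq enc_arc a | a : darc I <- enum 'I_(narc I)];
              enc_nat (source I); enc_nat (target I); enc_nat (ell I)].

(* A set of arcs is output as its characteristic vector. *)
Definition enc_solution (o : option {set darc I}) : tree :=
  if o is Some B
  then Node Leaf (enc_seq [seq tree_of_bool (a \in B) | a <- enum 'I_(narc I)])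
  else Leaf.

End FaultTolerantFlow.

(* The answer [None] reports that the instance has no feasible solution. *)
Definition approximates (rho : ftf_instance -> rat)
    (alg : forall I : ftf_instance, option {set darc I}) : Prop :=
  forall I : ftf_instance,
    match alg I with
    | Some B => feasible B /\
        forall S' : {set darc I}, feasible S' ->
          total_weight B <= rho I * total_weight S'
    | None => forall S : {set darc I}, ~ feasible S
    end.

(* Main.v *)
Require Import Defs.
From HB Require Import structures.
From mathcomp Require Import all_boot all_order all_algebra.
From mathcomp Require Import zify ring.

Set Implicit Arguments.
Unset Strict Implicit.
Unset Printing Implicit Defensive.

Import Order.TTheory GRing.Theory Num.Theory.

(** Give vulnerable arcs capacity [l] and the other arcs capacity [l + 1].  An
    s-t cut has capacity at least [l (l + 1)] iff it contains [l] safe arcs or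
    [l + 1] arcs; by Menger's theorem, if some arc is vulnerable, this holds for
    all s-t cuts of [S] iff [S] is feasible.  Hence the support of a minimum-cost integral flow of value
    [l (l + 1)] is feasible, and it weighs at most the cost of that flow; an
    optimal solution carries such a flow, whose cost is at most [l + 1] times
    its weight.

    The flow is found by a primal-dual method on unit copies of the arcs: grow
    a tree of residual arcs of reduced cost zero from the source; when it gets
    stuck, lower the reduced costs across its boundary by their minimum; when it
    reaches the target, reverse the tree path.  Only reduced costs are stored,
    so all numbers are natural, and they gain at most one bit per step. *)

(** A concrete machine must run the algorithm, so it is written with pairs, conditionals and
    [foldl], and closure lemmas for [pt] compile it. Folds are the only loops: the rounds must be
    supplied beforehand as a list, and every intermediate state needs a size bound. Hence the flow
    computation has a fixed number of rounds and idles once it is finished.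

    Unit copies need [ell] in unary, but it is given in binary and may be exponentially large. If
    the source differs from the target and some arc is vulnerable, a feasible set has [ell] arcs
    leaving the source; so an [ell] above the number of arcs means infeasibility, and otherwise
    unary is affordable. In the remaining cases the empty set is feasible.

    A flow is described by one identity valid for all potentials. Potentials with values 0 and 1
    turn it into statements about cuts, the dual potential gives optimality, and along a path it
    telescopes; no conservation law at single vertices is ever handled. *)

Lemma tree_eqbP : Equality.axiom tree_eqb.
Proof.
elim=> [|a IHa b IHb] [|c d] /=; try by constructor.
by apply: (iffP andP) => [[/IHa-> /IHb->]|[<- <-]] //; split; [apply/IHa|apply/IHb].
Qed.
HB.instance Definition _ := hasDecEq.Build tree tree_eqbP.

(** * Encodings of types as trees, and their sizes *)

Class Enc (A : Type) := enc : A -> tree.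
#[export] Instance enc_tree : Enc tree := id.
#[export] Instance enc_bool : Enc bool := tree_of_bool.
#[export] Instance enc_prod A B (eA : Enc A) (eB : Enc B) : Enc (A * B) :=
  fun p => Node (enc p.1) (enc p.2).
#[export] Instance enc_list A (eA : Enc A) : Enc (seq A) :=
  fun s => enc_seq (map enc s).
#[export] Instance enc_option A (eA : Enc A) : Enc (option A) :=
  fun o => if o is Some a then Node Leaf (enc a) else Leaf.

Definition esize {A} {eA : Enc A} (a : A) : nat := tree_size (enc a).

Lemma tree_size_gt0 d : 0 < tree_size d. Proof. by case: d. Qed.

Lemma esize_gt0 A {eA : Enc A} (a : A) : 0 < esize a.
Proof. exact: tree_size_gt0. Qed.

Ltac gt0 a := pose proof (esize_gt0 a).

Lemma esize_pair A B (eA : Enc A) (eB : Enc B) (p : A * B) :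
  esize p = (esize p.1 + esize p.2).+1.
Proof. by []. Qed.

Lemma esize_cons A (eA : Enc A) (x : A) s : esize (x :: s) = (esize x + esize s).+1.
Proof. by []. Qed.

Lemma esize_bool (b : bool) : esize b <= 3. Proof. by case: b. Qed.

Lemma size_le_esize A {eA : Enc A} (s : seq A) : size s <= esize s.
Proof. by elim: s => //= x s IH; rewrite esize_cons; lia. Qed.

Lemma esize_rev A {eA : Enc A} (s : seq A) : esize (rev s) = esize s.
Proof.
(* The extra 1 is the [Leaf] that ends [s] and disappears when the lists are joined. *)
have H : forall r : seq A, (esize (catrev s r)).+1 = esize s + esize r; last first.
  by have := H [::]; rewrite /rev; change (esize [::]) with 1%N; lia.
elim: s => [|x s IH] r /=; first by change (esize [::]) with 1%N; lia.
by rewrite IH !esize_cons; lia.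
Qed.

Lemma esize_seq_le A {eA : Enc A} B (s : seq A) :
  all (fun e => esize e <= B) s -> esize s <= (size s * B.+1).+1.
Proof. by elim: s => //= x s IH /andP[h /IH]; rewrite esize_cons; lia. Qed.

Lemma all_esize A {eA : Enc A} (s : seq A) : all (fun e => esize e <= esize s) s.
Proof.
have H : forall B, esize s <= B -> all (fun e => esize e <= B) s; last by apply: H.
elim: s => //= x s IH B; rewrite esize_cons => h; rewrite IH ?andbT; lia.
Qed.

(** * Polynomially bounded functions *)

(** Since the base is at least 2, a larger exponent absorbs constants and sums, and one number
    describes the whole bound. *)
Definition pb {A} {eA : Enc A} (g : A -> nat) : Prop :=
  exists e, forall a, g a <= (esize a + 2) ^ e.

Section PolyBound.
Context {A : Type} {eA : Enc A}.
Implicit Types g h : A -> nat.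

Lemma pb_le g h : (forall a, g a <= h a) -> pb h -> pb g.
Proof. by move=> le [e H]; exists e => a; apply: leq_trans (le a) (H a). Qed.

Lemma exp_base_mono (a : A) e e' : e <= e' -> (esize a + 2) ^ e <= (esize a + 2) ^ e'.
Proof. by move=> le; rewrite leq_exp2l //; lia. Qed.

Lemma pb_cst c : pb (fun _ : A => c).
Proof.
exists c => a; apply: leq_trans (ltnW (ltn_expl c (isT : 1 < 2))) _.
by case: c => // c; rewrite leq_exp2r //; lia.
Qed.

Lemma pb_add g h : pb g -> pb h -> pb (fun a => g a + h a).
Proof.
move=> [e H] [e' H']; exists (maxn e e').+1 => a.
have := H a; have := H' a.
have := exp_base_mono a (leq_maxl e e'); have := exp_base_mono a (leq_maxr e e').
rewrite expnS; nia.
Qed.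

Lemma pb_mul g h : pb g -> pb h -> pb (fun a => g a * h a).
Proof. by move=> [e H] [e' H']; exists (e + e') => a; rewrite expnD leq_mul. Qed.

Lemma pb_esize : pb (fun a : A => esize a).
Proof. by exists 1 => a; rewrite expn1; lia. Qed.

Lemma pb_S g : pb g -> pb (fun a => (g a).+1).
Proof. by move=> h; apply: pb_le (pb_add h (pb_cst 1)) => a; lia. Qed.

Lemma pb_exp g k : pb g -> pb (fun a => g a ^ k).
Proof.
move=> h; elim: k => [|k IH]; first exact: (pb_cst 1).
by apply: pb_le (pb_mul h IH) => a; rewrite expnS.
Qed.

(** Meant for arguments [b] that are not a function of [a], such as the state in the middle of a
    loop, of which only a size bound is known. *)
Lemma pb_comp_le B (eB : Enc B) (g : B -> nat) (m : A -> nat) :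
  pb g -> pb m ->
  exists2 h, pb h & forall a b, esize b <= m a -> g b <= h a.
Proof.
move=> [e H] pm; exists (fun a => (m a + 2) ^ e).
  exact/pb_exp/pb_add/pb_cst.
move=> a b le; apply: leq_trans (H b) _.
by case: (e) => // e'; rewrite leq_exp2r // leq_add2r.
Qed.

Lemma pb_comp B (eB : Enc B) (g : B -> nat) (f : A -> B) :
  pb g -> pb (fun a => esize (f a)) -> pb (fun a => g (f a)).
Proof.
by move=> pg pf; have [h ph le] := pb_comp_le pg pf; apply: pb_le ph => a; apply: le.
Qed.

End PolyBound.

Ltac pb_tac := repeat first
  [ assumption
  | match goal with
    | |- pb (fun _ => ?c) => exact (pb_cst c)
    | |- pb (fun a => addn (@?f a) (@?g a)) => apply: pb_add
    | |- pb (fun a => muln (@?f a) (@?g a)) => apply: pb_mul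
    | |- pb (fun a => S (@?f a)) => apply: pb_S
    | |- pb esize => exact: pb_esize
    | |- pb (fun a => esize a) => exact: pb_esize
    end ].

(** * Polynomial-time functions between encoded types *)

(* The command [C n] reads its argument in, and writes its result to, variable
   [n]; it may overwrite the variables above [n] but no others, so that nested
   computations need no renaming. *)
Definition computes {A B} {eA : Enc A} {eB : Enc B} (f : A -> B)
    (C : nat -> cmd) (t : A -> nat) : Prop :=
  forall n st a, st n = enc a ->
    exists k st', [/\ exec (C n) st k st', st' n = enc (f a),
                      (forall j, j < n -> st' j = st j) & k <= t a].

(** The bound on the size of the result is what composition needs; carrying it along avoids deriving
    it from the cost of the program. *)
Definition pt {A B} {eA : Enc A} {eB : Enc B} (f : A -> B) : Prop :=
  (exists C t, pb t /\ computes f C t) /\ pb (fun a => esize (f a)).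

Lemma upd_eq st x d : upd st x d x = d. Proof. by rewrite /upd eqxx. Qed.
Lemma upd_neq st x d y : y != x -> upd st x d y = st y.
Proof. by rewrite /upd => /negbTE->. Qed.

Ltac updr := rewrite /upd; repeat (case: eqP => ?; try (exfalso; lia)); try done.

Section Combinators.
Context {A : Type} {eA : Enc A}.

(** Programs see only encodings, so a change of type is free: a nonempty list is a pair, and [Some]
    is a pair with [Leaf]. *)
Lemma pt_recode B B' (eB : Enc B) (eB' : Enc B') (f : A -> B) (f' : A -> B') :
  (forall a, enc (f a) = enc (f' a)) -> pt f -> pt f'.
Proof.
move=> E [[C [t [pt' H]]] ps]; split; last first.
  by apply: pb_le ps => a; rewrite /esize E.
exists C, t; split=> // n st a /H[k [st' [? e ? ?]]].
by exists k, st'; split=> //; rewrite e.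
Qed.

Lemma pt_ext B (eB : Enc B) (f f' : A -> B) : f =1 f' -> pt f -> pt f'.
Proof. by move=> E; apply: pt_recode => a; rewrite E. Qed.

Lemma pt_id : pt (fun a : A => a).
Proof.
split; last exact: pb_esize.
exists (fun=> CSkip), (fun=> 1); split; first exact: pb_cst.
by move=> n st a e; exists 1, st; split=> //; constructor.
Qed.

Fixpoint const_expr (d : tree) : expr :=
  if d is Node l r then ECons (const_expr l) (const_expr r) else ENil.

Lemma eval_const st d : eval st (const_expr d) = d.
Proof. by elim: d => //= l -> r ->. Qed.

Lemma ecost_const st st' d : ecost st (const_expr d) = ecost st' (const_expr d).
Proof. by elim: d => //= l -> r ->; rewrite !eval_const. Qed.

Lemma pt_cst B {eB : Enc B} (b : B) : pt (fun _ : A => b).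
Proof.
split; last exact: pb_cst.
exists (fun n => CAssign n (const_expr (enc b))).
exists (fun=> (ecost (fun=> Leaf) (const_expr (enc b))).+1); split; first exact: pb_cst.
move=> n st a e; eexists; eexists; split; first exact: exec_assign.
- by rewrite upd_eq eval_const.
- by move=> j lt; rewrite upd_neq //; lia.
- by rewrite (ecost_const _ (fun=> Leaf)).
Qed.

Lemma pt_comp B C (eB : Enc B) (eC : Enc C) (g : B -> C) (f : A -> B) :
  pt g -> pt f -> pt (fun a => g (f a)).
Proof.
move=> [[Cg [tg [ptg Hg]]] psg] [[Cf [tf [ptf Hf]]] psf]; split; last exact: pb_comp psg psf.
exists (fun n => CSeq (Cf n) (Cg n)), (fun a => tf a + tg (f a)); split.
  exact: pb_add ptf (pb_comp ptg psf).
move=> n st a /Hf[k [st1 [X1 e1 p1 le1]]].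
have [k' [st2 [X2 e2 p2 le2]]] := Hg n st1 (f a) e1.
exists (k + k'), st2; split=> //; first exact: exec_seq X1 X2.
- by move=> j lt; rewrite p2 ?p1.
- exact: leq_add.
Qed.

(** With [f] run at [n.+1] and [g] at [n.+2], the argument in [n] survives the first run and the
    value of [f] the second. *)
Lemma pt_pair B C (eB : Enc B) (eC : Enc C) (f : A -> B) (g : A -> C) :
  pt f -> pt g -> pt (fun a => (f a, g a)).
Proof.
move=> [[Cf [tf [ptf Hf]]] psf] [[Cg [tg [ptg Hg]]] psg]; split; last first.
  by apply: pb_le (pb_S (pb_add psf psg)) => a.
exists (fun n => CSeq (CAssign n.+1 (EVar n)) (CSeq (Cf n.+1)
  (CSeq (CAssign n.+2 (EVar n)) (CSeq (Cg n.+2)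
  (CAssign n (ECons (EVar n.+1) (EVar n.+2))))))).
exists (fun a => 10 + 2 * esize a + tf a + tg a + 2 * (esize (f a) + esize (g a))); split.
  by pb_tac.
move=> n st a ea.
have [k1 [st1 [X1 e1 p1 le1]]] := Hf n.+1 (upd st n.+1 (st n)) a
  ltac:(by rewrite upd_eq).
have s1n : st1 n = enc a by rewrite p1 ?upd_neq //; lia.
have [k2 [st2 [X2 e2 p2 le2]]] := Hg n.+2 (upd st1 n.+2 (st1 n)) a
  ltac:(by rewrite upd_eq).
have s2 : st2 n.+1 = enc (f a) by rewrite p2 ?upd_neq //; lia.
eexists; eexists; split.
- apply: exec_seq; first exact: exec_assign.
  apply: exec_seq; first exact: X1.
  apply: exec_seq; first exact: exec_assign.
  apply: exec_seq; first exact: X2.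
  exact: exec_assign.
- by rewrite upd_eq /= s2 e2.
- move=> j lt; rewrite upd_neq ?p2 ?upd_neq ?p1 ?upd_neq //; lia.
- by rewrite /= ea s1n s2 e2 /esize; lia.
Qed.

(** [is_node] is the native test of [CIf]; in this form it also serves for matching on lists and
    options. *)
Lemma pt_if_node B C (eB : Enc B) (eC : Enc C) (f : A -> B) (g h : A -> C) :
  pt f -> pt g -> pt h ->
  pt (fun a => if is_node (enc (f a)) then g a else h a).
Proof.
move=> [[Cf [tf [ptf Hf]]] psf] [[Cg [tg [ptg Hg]]] psg] [[Ch [th [pth Hh]]] psh].
split; last first.
  by apply: pb_le (pb_add psg psh) => a; case: ifP; lia.
exists (fun n => CSeq (CAssign n.+1 (EVar n)) (CSeq (Cf n.+1)
  (CIf (EVar n.+1) (Cg n) (Ch n)))).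
exists (fun a => 10 + esize a + tf a + tg a + th a + esize (f a)); split.
  by pb_tac.
move=> n st a ea.
have [k1 [st1 [X1 e1 p1 le1]]] := Hf n.+1 (upd st n.+1 (st n)) a
  ltac:(by rewrite upd_eq).
have s1n : st1 n = enc a by rewrite p1 ?upd_neq //; lia.
have [k2 [st2 [X2 e2 p2 le2]]] := Hg n st1 a s1n.
have [k3 [st3 [X3 e3 p3 le3]]] := Hh n st1 a s1n.
case: ifPn => c.
- eexists; exists st2; split; [|exact: e2| |].
  + apply: exec_seq; first exact: exec_assign.
    apply: exec_seq; first exact: X1.
    by apply: exec_if_true; rewrite /= ?e1 //; exact: X2.
  + by move=> j lt; rewrite p2 ?p1 ?upd_neq //; lia.
  + by rewrite /= ea e1 /esize; lia.
- eexists; exists st3; split; [|exact: e3| |].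
  + apply: exec_seq; first exact: exec_assign.
    apply: exec_seq; first exact: X1.
    by apply: exec_if_false; rewrite /= ?e1 //; exact: X3.
  + by move=> j lt; rewrite p3 ?p1 ?upd_neq //; lia.
  + by rewrite /= ea e1 /esize; lia.
Qed.

Lemma pt_if B (eB : Enc B) (b : A -> bool) (f g : A -> B) :
  pt b -> pt f -> pt g -> pt (fun a => if b a then f a else g a).
Proof.
move=> pb' pf pg; apply: pt_ext (pt_if_node pb' pf pg) => a.
by case: (b a).
Qed.

End Combinators.

(** Evaluation costs at least the size of the value, so the cost bound also bounds the result. *)
Lemma pt_expr A B (eA : Enc A) (eB : Enc B) (f : A -> B) (E : nat -> expr) c :
  (forall st n (a : A), st n = enc a -> eval st (E n) = enc (f a)) ->
  (forall st n (a : A), st n = enc a -> ecost st (E n) <= c * esize a) ->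
  pt f.
Proof.
move=> Hv Hc; split; last first.
  apply: (pb_le (h := fun a => c * esize a)); last exact/pb_mul/pb_esize/pb_cst.
  move=> a; apply: leq_trans (Hc (fun=> enc a) 0 a erefl).
  rewrite /esize -(Hv (fun=> enc a) 0 a erefl).
  by case: (E 0) => *; rewrite /= leq_addr.
exists (fun n => CAssign n (E n)), (fun a => (c * esize a).+1); split.
  exact/pb_S/pb_mul/pb_esize/pb_cst.
move=> n st a ea; eexists; eexists; split; first exact: exec_assign.
- by rewrite upd_eq (Hv _ _ _ ea).
- by move=> j lt; rewrite upd_neq //; lia.
- by rewrite ltnS Hc.
Qed.

Lemma size_hd d : tree_size (if d is Node l _ then l else Leaf) <= tree_size d.
Proof. by case: d => //= *; lia. Qed.
Lemma size_tl d : tree_size (if d is Node _ r then r else Leaf) <= tree_size d.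
Proof. by case: d => //= *; lia. Qed.

Section Projections.
Context {A : Type} {eA : Enc A}.

(** A condition on encodings covers both the first projection and [head false]: the empty list and
    [false] are both [Leaf]. *)
Lemma pt_hd B C (eB : Enc B) (eC : Enc C) (g : B -> C) (f : A -> B) :
  (forall b, enc (g b) = if enc b is Node l _ then l else Leaf) ->
  pt f -> pt (fun a => g (f a)).
Proof.
move=> Hg; apply: pt_comp; apply: (@pt_expr _ _ _ _ _ (fun n => EHd (EVar n)) 2).
- by move=> st n b /= ->; rewrite Hg.
- by move=> st n b /= ->; rewrite addn0 mul2n -addnn leq_add2r; exact: size_hd.
Qed.

Lemma pt_tl B C (eB : Enc B) (eC : Enc C) (g : B -> C) (f : A -> B) :
  (forall b, enc (g b) = if enc b is Node _ r then r else Leaf) ->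
  pt f -> pt (fun a => g (f a)).
Proof.
move=> Hg; apply: pt_comp; apply: (@pt_expr _ _ _ _ _ (fun n => ETl (EVar n)) 2).
- by move=> st n b /= ->; rewrite Hg.
- by move=> st n b /= ->; rewrite addn0 mul2n -addnn leq_add2r; exact: size_tl.
Qed.

Lemma pt_fst B C (eB : Enc B) (eC : Enc C) (f : A -> B * C) :
  pt f -> pt (fun a => (f a).1).
Proof. exact: pt_hd. Qed.

Lemma pt_snd B C (eB : Enc B) (eC : Enc C) (f : A -> B * C) :
  pt f -> pt (fun a => (f a).2).
Proof. exact: pt_tl. Qed.

Lemma pt_head_bits (f : A -> seq bool) : pt f -> pt (fun a => head false (f a)).
Proof. by apply: pt_hd => -[]. Qed.

Lemma pt_behead B (eB : Enc B) (f : A -> seq B) : pt f -> pt (fun a => behead (f a)).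
Proof. by apply: pt_tl => -[]. Qed.

Lemma pt_cons B (eB : Enc B) (f : A -> B) (g : A -> seq B) :
  pt f -> pt g -> pt (fun a => f a :: g a).
Proof. by move=> pf pg; apply: pt_recode (pt_pair pf pg). Qed.

Lemma pt_some B (eB : Enc B) (f : A -> B) : pt f -> pt (fun a => Some (f a)).
Proof. 
move=> pf; apply: (pt_recode (f := fun a => (Leaf, f a))) => //.
by apply: pt_pair => //; exact: pt_cst.
 Qed.

Lemma pt_node (f g : A -> tree) : pt f -> pt g -> pt (fun a => Node (f a) (g a)).
Proof. by move=> pf pg; apply: pt_recode (pt_pair pf pg). Qed.

Lemma pt_eq (f g : A -> tree) : pt f -> pt g -> pt (fun a => f a == g a).
Proof.
move=> pf pg; apply: (pt_comp (g := fun p : tree * tree => p.1 == p.2) _ (pt_pair pf pg)).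
apply: (@pt_expr _ _ _ _ _ (fun n => EEq (EHd (EVar n)) (ETl (EVar n))) 7).
- by move=> st n [a b] /= ->.
- move=> st n [a b] /= ->; rewrite /esize /enc /enc_prod /= /enc /enc_tree.
  by case: tree_eqb => /=; have := tree_size_gt0 a; have := tree_size_gt0 b; lia.
Qed.

Lemma pt_and (f g : A -> bool) : pt f -> pt g -> pt (fun a => f a && g a).
Proof. by move=> pf pg; exact: (pt_if pf pg (pt_cst false)). Qed.
Lemma pt_or (f g : A -> bool) : pt f -> pt g -> pt (fun a => f a || g a).
Proof. by move=> pf pg; exact: (pt_if pf (pt_cst true) pg). Qed.
Lemma pt_neg (f : A -> bool) : pt f -> pt (fun a => ~~ f a).
Proof. by move=> pf; exact: (pt_if pf (pt_cst false) (pt_cst true)). Qed.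
Lemma pt_xor (f g : A -> bool) : pt f -> pt g -> pt (fun a => f a (+) g a).
Proof. by move=> pf pg; apply: pt_ext (pt_if pf (pt_neg pg) pg) => a; case: (f a). Qed.

Lemma pt_nilp B (eB : Enc B) (f : A -> seq B) : pt f -> pt (fun a => nilp (f a)).
Proof.
move=> pf; apply: pt_ext (pt_if_node pf (pt_cst false) (pt_cst true)) => a.
by case: (f a).
Qed.

(* The unused projection of a [None] must still be typed, hence [b0]. *)
Lemma pt_option B C (eB : Enc B) (eC : Enc C) (b0 : B) (f : A -> option B)
    (g : A -> B -> C) (h : A -> C) :
  pt f -> pt (fun q : A * B => g q.1 q.2) -> pt h ->
  pt (fun a => if f a is Some b then g a b else h a).
Proof.
move=> pf pg ph; pose ub o := if o is Some b then b else b0.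
have pu : pt (fun a => ub (f a)).
  pose tlt (o : option B) := if @enc _ (enc_option eB) o is Node _ r then r else Leaf.
  have p1 : pt (fun a => tlt (f a)) by exact: (pt_tl (g := tlt)).
  apply: pt_recode (pt_if_node pf p1 (pt_cst (enc b0))) => a.
  by rewrite /tlt; case: (f a).
have := pt_if_node pf (pt_comp pg (pt_pair pt_id pu)) ph.
by apply: pt_ext => a /=; case: (f a).
Qed.

Lemma pt_comp2 B C D (eB : Enc B) (eC : Enc C) (eD : Enc D) (F : B -> C -> D)
    (f : A -> B) (g : A -> C) :
  pt (fun q : B * C => F q.1 q.2) -> pt f -> pt g -> pt (fun a => F (f a) (g a)).
Proof. by move=> pF pf pg; apply: pt_comp pF (pt_pair pf pg). Qed.

Lemma pt_comp3 B C D E (eB : Enc B) (eC : Enc C) (eD : Enc D) (eE : Enc E)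
    (F : B -> C -> D -> E) (f : A -> B) (g : A -> C) (h : A -> D) :
  pt (fun q : B * (C * D) => F q.1 q.2.1 q.2.2) -> pt f -> pt g -> pt h ->
  pt (fun a => F (f a) (g a) (h a)).
Proof. by move=> pF pf pg ph; apply: pt_comp pF (pt_pair pf (pt_pair pg ph)). Qed.

End Projections.

Section Fold.
Context {A S E : Type} {eA : Enc A} {eS : Enc S} {eE : Enc E}.
Variables (step : A -> S -> E -> S) (init : A -> S) (l : A -> seq E).

(** The list bounds the number of rounds. The size bound over all prefixes is essential: a step that
    doubles its state is polynomial by itself, but its iteration is not. *)
Lemma pt_foldl (M : A -> nat) :
  pt (fun q : A * (S * E) => step q.1 q.2.1 q.2.2) -> pt init -> pt l -> pb M ->
  (forall a i, esize (foldl (step a) (init a) (take i (l a))) <= M a) ->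
  pt (fun a => foldl (step a) (init a) (l a)).
Proof.
move=> [[Cs [ts [pts Hs]]] pss] [[Ci [ti [pti Hi]]] psi] [[Cl [tl [ptl Hl]]] psl] pM HM.
split; last first.
  by apply: pb_le pM => a; have := HM a (size (l a)); rewrite take_size.
pose (m := fun a => esize a + M a + esize (l a) + 2).
have pm : pb m by rewrite /m; pb_tac.
(* [m a] bounds the argument of every call of [step], hence [T a] the cost of a call and [W a] that
   of a round. *)
have [T pT leT] := pb_comp_le pts pm.
pose W a := 20 + 10 * m a + T a.
have pW : pb W by rewrite /W; pb_tac.
(* Variable [n] keeps the parameter, [n.+1] the state, [n.+2] the rest of the list; [step] works at
   [n.+3]. *)
pose body n := CSeq (CAssign n.+3 (ECons (EVar n) (ECons (EVar n.+1) (EHd (EVar n.+2)))))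
  (CSeq (Cs n.+3) (CSeq (CAssign n.+1 (EVar n.+3)) (CAssign n.+2 (ETl (EVar n.+2))))).
have loop n a r s st : st n = enc a -> st n.+1 = enc s -> st n.+2 = enc r ->
    esize r <= esize (l a) ->
    (forall i, esize (foldl (step a) s (take i r)) <= M a) ->
    exists k st', [/\ exec (CWhile (EVar n.+2) (body n)) st k st',
      st' n.+1 = enc (foldl (step a) s r), (forall j, j < n -> st' j = st j)
      & k <= (size r).+1 * W a].
  elim: r s st => [|x r IH] s st e0 e1 e2 lr Hb.
    exists (ecost st (EVar n.+2)).+1, st; split=> //.
      by apply: exec_while_false; rewrite /= e2.
    by rewrite /= e2 /= mul1n /W; lia.
  pose (st1 := upd st n.+3 (enc (a, (s, x)))).
  have [k1 [st2 [X1 f1 p1 le1]]] := Hs n.+3 st1 (a, (s, x)) (upd_eq _ _ _).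
  pose (st3 := upd st2 n.+1 (enc (step a s x))).
  pose (st4 := upd st3 n.+2 (enc r)).
  have Hb0 := Hb 0; have Hb1 := Hb 1; rewrite /= take0 /= in Hb0 Hb1.
  have [|||||k2 [st' [X2 g1 q1 le2]]] := IH (step a s x) st4.
  - by rewrite /st4 /st3; updr; rewrite p1 /st1; [updr | lia].
  - by rewrite /st4 /st3; updr.
  - by rewrite /st4; updr.
  - by move: lr; rewrite esize_cons; lia.
  - by move=> i; have := Hb i.+1.
  eexists; exists st'; split; last first.
  - instantiate (1 := (ecost st (EVar n.+2) + ((ecost st (ECons (EVar n)
      (ECons (EVar n.+1) (EHd (EVar n.+2))))).+1 + (k1 + ((ecost st2 (EVar n.+3)).+1 +
      (ecost st3 (ETl (EVar n.+2))).+1))) + k2).+1).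
    have e3 : st3 n.+2 = enc (x :: r).
      by rewrite /st3; updr; rewrite p1 /st1; [updr | lia].
    have les : esize (a, (s, x)) <= m a.
      by move: lr; rewrite !esize_pair esize_cons /= /m; lia.
    have := leT a _ les; move: (leq_trans le1 (leqnn _)) => /=.
    rewrite /= e0 e1 e2 e3 f1 /=.
    have : 20 + 10 * m a + T a <= W a by [].
    set z := tree_size (enc_seq _); have : z = tree_size (enc r) by [].
    rewrite [m a]/m [(size r).+2 * _]mulSn; move: lr le2 Hb0 Hb1; rewrite !esize_cons /esize.
    by set v := _ * W a; clearbody v z; clear; lia.
  - by move=> j lt; rewrite q1 // /st4 /st3; updr; rewrite p1 /st1; [updr | lia].
  - by rewrite g1.
  - apply: exec_while_true; first by rewrite /= e2.
      apply: exec_seq; first exact: exec_assign.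
      rewrite /= e0 e1 e2 /=.
      apply: exec_seq; first exact: X1.
      apply: exec_seq; first exact: exec_assign.
      by rewrite /= f1; exact: exec_assign.
    have e3 : st3 n.+2 = enc (x :: r).
      by rewrite /st3; updr; rewrite p1 /st1; [updr | lia].
    by rewrite -/st3 /= e3.
exists (fun n => CSeq (CAssign n.+1 (EVar n)) (CSeq (Ci n.+1)
  (CSeq (CAssign n.+2 (EVar n)) (CSeq (Cl n.+2)
  (CSeq (CWhile (EVar n.+2) (body n)) (CAssign n (EVar n.+1))))))).
exists (fun a => 10 + 2 * esize a + ti a + tl a + (esize (l a)).+1 * W a + M a); split.
  by pb_tac.
move=> n st a ea.
have [k1 [st1 [X1 e1 p1 le1]]] := Hi n.+1 (upd st n.+1 (st n)) a
  ltac:(by rewrite upd_eq).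
have s1n : st1 n = enc a by rewrite p1 ?upd_neq //; lia.
have [k2 [st2 [X2 e2 p2 le2]]] := Hl n.+2 (upd st1 n.+2 (st1 n)) a
  ltac:(by rewrite upd_eq).
have [|||||k3 [st3 [X3 e3 p3 le3]]] := loop n a (l a) (init a) st2.
- by rewrite p2 ?upd_neq //; lia.
- by rewrite p2 ?upd_neq //; lia.
- by [].
- by [].
- by move=> i; exact: HM.
eexists; eexists; split.
- apply: exec_seq; first exact: exec_assign.
  apply: exec_seq; first exact: X1.
  apply: exec_seq; first exact: exec_assign.
  apply: exec_seq; first exact: X2.
  apply: exec_seq; first exact: X3.
  exact: exec_assign.
- by rewrite upd_eq /= e3.
- move=> j lt; rewrite upd_neq ?p3 ?p2 ?upd_neq ?p1 ?upd_neq //; lia.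
- have := HM a (size (l a)); rewrite take_size => leM.
  have : (size (l a)).+1 * W a <= (esize (l a)).+1 * W a.
    by rewrite leq_mul2r ltnS size_le_esize orbT.
  by rewrite /= ea s1n e3; move: leM le1 le2 le3; rewrite /esize; lia.
Qed.

(** Growth proportional to the element read sums to at most [g a * esize (l a)]. The measure may be
    a number of bits where that is easier to follow than [esize]. *)
Lemma pt_foldl_grow (m : S -> nat) c (g : A -> nat) :
  (forall s, esize s <= c * (m s).+1) ->
  (forall a s e, m (step a s e) <= m s + g a * esize e) ->
  pb (fun a => m (init a)) -> pb g ->
  pt (fun q : A * (S * E) => step q.1 q.2.1 q.2.2) -> pt init -> pt l ->
  pt (fun a => foldl (step a) (init a) (l a)).
Proof.
move=> Hm Hg pmi pg pst pin pl.
apply: (@pt_foldl (fun a => c * (m (init a) + g a * esize (l a)).+1)) => //.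
  apply/pb_mul; first exact: pb_cst.
  by apply/pb_S/pb_add => //; apply: pb_mul => //; case: pl.
move=> a i; apply: leq_trans (Hm _) _; rewrite leq_mul2l; apply/orP; right; rewrite ltnS.
elim: (l a) (init a) i => [|x r IH] s [|i] //=; try lia.
apply: leq_trans (IH _ _) _; rewrite esize_cons.
by have := Hg a s x; rewrite -addn1 !mulnDr; lia.
Qed.

End Fold.

Section Reverse.
Context {A E : Type} {eA : Enc A} {eE : Enc E}.

Lemma pt_rev (l : A -> seq E) : pt l -> pt (fun a => rev (l a)).
Proof.
move=> pl; pose step (a : A) := fun (s : seq E) e => e :: s.
apply: (pt_ext (f := fun a => foldl (step a) [::] (l a))).
  by move=> a; rewrite /rev; elim: (l a) [::] => //= x s IH r; rewrite IH.
apply: (pt_foldl_grow (m := esize) (c := 1) (g := fun=> 2)) => //.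
- by move=> s; lia.
- by move=> a s e; rewrite /step esize_cons /=; gt0 e; lia.
- exact: pb_cst.
- exact: pb_cst.
- by apply: pt_cons; [apply: pt_snd|apply: pt_fst]; apply: pt_snd; exact: pt_id.
- exact: pt_cst.
Qed.

End Reverse.

Section MapHas.
Context {A E F : Type} {eA : Enc A} {eE : Enc E} {eF : Enc F}.

Lemma pt_map (f : A -> E -> F) (l : A -> seq E) :
  pt (fun q : A * E => f q.1 q.2) -> pt l -> pt (fun a => map (f a) (l a)).
Proof.
move=> pf pl; pose step (a : A) := fun (s : seq F) e => f a e :: s.
have foldE a r s : foldl (step a) r s = rev (map (f a) s) ++ r.
  by elim: s r => //= x s IH r; rewrite IH rev_cons cat_rcons.
apply: (pt_ext (f := fun a => rev (foldl (step a) [::] (l a)))).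
  by move=> a; rewrite foldE cats0 revK.
apply: pt_rev.
have pm : pb (fun a => esize a + esize (l a) + 1).
  by have [_ ?] := pl; pb_tac.
(* No element is larger than the list, so [h a] bounds all images at once. *)
have [h ph leh] := pb_comp_le (proj2 pf) pm.
apply: (pt_foldl (M := fun a => (esize (l a) * (h a).+1).+1)) => //.
- apply: pt_cons; last by apply/pt_fst/pt_snd/pt_id.
  apply: (pt_comp2 pf); first by apply/pt_fst/pt_id.
  by apply/pt_snd/pt_snd/pt_id.
- exact: pt_cst.
- by have [_ ?] := pl; pb_tac.
move=> a i; rewrite foldE cats0 esize_rev.
have H : all (fun e => esize e <= h a) (map (f a) (take i (l a))).
  rewrite all_map; move: (all_esize (eA := eE) (l a)); rewrite -{2}(cat_take_drop i (l a)) all_cat.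
  case/andP=> Ha _; apply: sub_all Ha => e le /=.
  by apply: (leh a (a, e)); rewrite esize_pair /=; lia.
apply: leq_trans (esize_seq_le H) _; rewrite ltnS leq_mul2r; apply/orP; right.
by rewrite size_map (leq_trans _ (size_le_esize _)) // size_take; case: ltnP => // /ltnW.
Qed.

Lemma pt_has (p : A -> E -> bool) (l : A -> seq E) :
  pt (fun q : A * E => p q.1 q.2) -> pt l -> pt (fun a => has (p a) (l a)).
Proof.
move=> pp pl; pose step a := fun b e => b || p a e.
have foldE a b s : foldl (step a) b s = b || has (p a) s.
  by elim: s b => [|x s IH] b /=; rewrite ?orbF // IH orbA.
apply: (pt_ext (f := fun a => foldl (step a) false (l a))) => //.
apply: (pt_foldl (M := fun=> 3)) => //.
- apply: pt_or; first by apply/pt_fst/pt_snd/pt_id.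
  apply: (pt_comp2 pp); first by apply/pt_fst/pt_id.
  by apply/pt_snd/pt_snd/pt_id.
- exact: pt_cst.
- exact: pb_cst.
- by move=> a i; exact: esize_bool.
Qed.

End MapHas.

Lemma pt_mem A (eA : Enc A) (f : A -> tree) (l : A -> seq tree) :
  pt f -> pt l -> pt (fun a => f a \in l a).
Proof.
move=> pf pl; apply: (pt_comp2 (F := fun x (s : seq tree) => x \in s) _ pf pl).
apply: (pt_ext (f := fun q => has (fun y => y == q.1) q.2)).
  by move=> q; rewrite -has_pred1.
apply: pt_has; last exact/pt_snd/pt_id.
by apply: pt_eq; [apply/pt_snd/pt_id | apply/pt_fst/pt_fst/pt_id].
Qed.

Ltac pt_step := match goal with
  | |- pt (fun x => x) => exact: pt_id
  | |- pt fst => exact: (pt_fst pt_id)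
  | |- pt snd => exact: (pt_snd pt_id)
  | |- pt (fun _ => ?c) => exact: (pt_cst c)
  | |- pt (fun x => (@?f x, @?g x)) => apply: pt_pair
  | |- pt (fun x => fst (@?f x)) => apply: pt_fst
  | |- pt (fun x => snd (@?f x)) => apply: pt_snd
  | |- pt (fun x => cons (@?f x) (@?g x)) => apply: pt_cons
  | |- pt (fun x => head false (@?f x)) => apply: pt_head_bits
  | |- pt (fun x => behead (@?f x)) => apply: pt_behead
  | |- pt (fun x => Some (@?f x)) => apply: pt_some
  | |- pt (fun x => Node (@?f x) (@?g x)) => apply: pt_node
  | |- pt (fun x => @?f x == @?g x) => apply: pt_eq
  | |- pt (fun x => @?f x \in @?g x) => apply: pt_mem
  | |- pt (fun x => andb (@?f x) (@?g x)) => apply: pt_and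
  | |- pt (fun x => orb (@?f x) (@?g x)) => apply: pt_or
  | |- pt (fun x => addb (@?f x) (@?g x)) => apply: pt_xor
  | |- pt (fun x => negb (@?f x)) => apply: pt_neg
  | |- pt (fun x => nilp (@?f x)) => apply: pt_nilp
  | |- pt (fun x => rev (@?f x)) => apply: pt_rev
  | |- pt (fun x => map _ _) => apply: pt_map
  | |- pt (fun x => has _ _) => apply: pt_has
  end.
Ltac pt_user := fail.
Ltac pt_tac := cbv beta zeta; repeat first [assumption | pt_step | pt_user | apply: pt_if].

(** * Binary arithmetic *)

(* Least significant bit first; leading zeros are allowed. *)
Definition bval (b : seq bool) : nat := foldr (fun (x : bool) n => x + n.*2) 0 b.

Lemma bval_cat a b : bval (a ++ b) = bval a + 2 ^ size a * bval b.
Proof. by elim: a => [|x a IH] /=; rewrite ?mul1n // IH expnS; lia. Qed.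

Lemma bval_ub b : bval b < 2 ^ size b.
Proof. by elim: b => //= x b IH; rewrite expnS; lia. Qed.

Lemma bval_eq0 b : (bval b == 0) = ~~ has id b.
Proof. by elim: b => //= x b IH; case: x => //=; rewrite -IH; lia. Qed.

Lemma esize_bits (b : seq bool) : esize b <= 4 * (size b).+1.
Proof. by elim: b => //= x b; rewrite esize_cons; have := esize_bool x; lia. Qed.

(** State: the borrow, the unread digits of the subtrahend, and the digits of the difference, latest
    first. *)
Definition sub_step (s : bool * seq bool * seq bool) (x : bool) :=
  (let y := head false s.1.2 in
   ((~~ x && (y || s.1.1)) || (y && s.1.1), behead s.1.2, (x (+) y (+) s.1.1) :: s.2)).

Definition sub_run (a b : seq bool) := foldl sub_step (false, b, [::]) a.

Definition bsub a b := rev (sub_run a b).2.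

(** Subtraction underflows iff a borrow is left or [b] has a nonzero digit beyond the length of
    [a]. *)
Definition blt a b := (sub_run a b).1.1 || has id (sub_run a b).1.2.

Lemma head_behead (b : seq bool) : bval b = head false b + (bval (behead b)).*2.
Proof. by case: b. Qed.

(** The loop invariant of subtraction, with the subtracted terms moved across the equation so that
    it can be stated in [nat]. *)
Lemma sub_stepE a s :
  let r := foldl sub_step s a in
  bval (rev s.2) + 2 ^ size s.2 * bval a + 2 ^ size r.2 * (bval r.1.2 + r.1.1) =
  bval (rev r.2) + 2 ^ size s.2 * (bval s.1.2 + s.1.1) /\ size r.2 = size s.2 + size a.
Proof.
elim: a s => [|x a IH] [[c b] acc] /=; first by lia.
have [E Es] := IH (sub_step (c, b, acc) x); split; last by rewrite Es /=; lia.
clear Es.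
move: E; set r := foldl _ _ _; rewrite /= rev_cons -cats1 bval_cat size_rev expnS /=.
rewrite [bval b]head_behead; move: (head false b) (bval (behead b)) => y v.
move: (bval r.1.2) (nat_of_bool r.1.1) (bval (rev r.2)) (2 ^ size r.2) => rb rc ra q.
move: (2 ^ size acc) (bval (rev acc)) (bval a) => p va wa; clear.
by case: x; case: y; case: c => /=; nia.
Qed.

Lemma sub_runE a b (r := sub_run a b) :
  bval a + 2 ^ size a * (bval r.1.2 + r.1.1) = bval (rev r.2) + bval b /\
  size r.2 = size a.
Proof.
have [E S] := sub_stepE a (false, b, [::]); rewrite -/(sub_run a b) -/r in E S.
by rewrite S /= add0n mul1n expn0 mul1n addn0 in E *.
Qed.

Lemma size_bsub a b : size (bsub a b) = size a.
Proof. by rewrite size_rev; have [] := sub_runE a b. Qed.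

Lemma bltE a b : blt a b = (bval a < bval b).
Proof.
have [E S] := sub_runE a b; rewrite /blt.
have := bval_ub (rev (sub_run a b).2); rewrite size_rev S.
have := bval_eq0 (sub_run a b).1.2.
move: E; set v := bval (sub_run a b).1.2; set c := (sub_run a b).1.1.
set h := has _ _; set p := 2 ^ _; clearbody v c h p.
case: c; case: h => /=; case: eqP => [->|] //=; nia.
Qed.

Lemma bsubE a b : bval b <= bval a -> bval (bsub a b) = bval a - bval b.
Proof.
have [E S] := sub_runE a b; rewrite /bsub.
have := bval_ub (rev (sub_run a b).2); rewrite size_rev S.
move: E; set v := bval (sub_run a b).1.2; set c := (sub_run a b).1.1; set p := 2 ^ _.
by case: (v + c) => [|n]; nia.
Qed.

Definition add_step (s : bool * seq bool * seq bool) (x : bool) :=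
  (let y := head false s.1.2 in
   ((x && (y || s.1.1)) || (y && s.1.1), behead s.1.2, (x (+) y (+) s.1.1) :: s.2)).

Definition carry_step (s : bool * seq bool) (x : bool) :=
  (s.1 && x, (s.1 (+) x) :: s.2).

(* After the digits of [a] are used up, only the carry remains to be added to
   the rest of [b]. *)
Definition badd a b :=
  let r := foldl add_step (false, b, [::]) a in
  let r' := foldl carry_step (r.1.1, r.2) r.1.2 in
  rev (r'.1 :: r'.2).

Lemma add_stepE a s :
  let r := foldl add_step s a in
  bval (rev r.2) + 2 ^ size r.2 * (bval r.1.2 + r.1.1) =
  bval (rev s.2) + 2 ^ size s.2 * (bval a + bval s.1.2 + s.1.1) /\
  size r.2 = size s.2 + size a /\ size r.1.2 = size s.1.2 - size a.
Proof.
elim: a s => [|x a IH] [[c b] acc] /=; first by rewrite subn0; lia.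
have [E [Es Es']] := IH (add_step (c, b, acc) x); split; last first.
  by rewrite Es Es' /= size_behead; split; lia.
move: E; set r := foldl _ _ _ => ->; rewrite /= rev_cons -cats1 bval_cat size_rev expnS /=.
rewrite [bval b]head_behead; move: (head false b) (bval (behead b)) => y v.
move: (2 ^ size acc) (bval (rev acc)) (bval a) => p va wa; clear.
by case: x; case: y; case: c => /=; nia.
Qed.

Lemma carry_stepE b s :
  let r := foldl carry_step s b in
  bval (rev r.2) + 2 ^ size r.2 * r.1 =
  bval (rev s.2) + 2 ^ size s.2 * (bval b + s.1) /\ size r.2 = size s.2 + size b.
Proof.
elim: b s => [|x b IH] [c acc] /=; first by lia.
have [E Es] := IH (carry_step (c, acc) x); split; [rewrite E | by rewrite Es /=; lia].
rewrite /= rev_cons -cats1 bval_cat size_rev expnS /=.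
move: (2 ^ size acc) (bval (rev acc)) (bval b) => p va wa; clear.
by case: x; case: c => /=; nia.
Qed.

Lemma baddE a b : bval (badd a b) = bval a + bval b.
Proof.
rewrite /badd rev_cons -cats1 bval_cat size_rev /=.
have [E1 _] := add_stepE a (false, b, [::]).
set r := foldl add_step _ _ in E1 *.
have [E2 _] := carry_stepE r.1.2 (r.1.1, r.2).
by move: E2 E1 => /=; rewrite /= !addn0 => -> ->; rewrite mul1n.
Qed.

Lemma size_badd a b : size (badd a b) = (maxn (size a) (size b)).+1.
Proof.
rewrite /badd size_rev /=.
have [_ [E1 E1']] := add_stepE a (false, b, [::]).
set r := foldl add_step _ _ in E1 E1' *.
have [_ ->] := carry_stepE r.1.2 (r.1.1, r.2).
by rewrite E1 E1' /=; lia.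
Qed.

(** Horner's rule from the most significant digit, hence [rev a]. *)
Definition bmul a b :=
  foldl (fun acc (x : bool) => if x then badd (false :: acc) b else false :: acc)
    [::] (rev a).

Lemma bmulE a b : bval (bmul a b) = bval a * bval b.
Proof.
rewrite /bmul foldl_rev; elim: a => //= x a IH.
by case: x; rewrite ?baddE /= IH; lia.
Qed.

(** A shift and an addition contribute one digit each. The coefficient 1 of [size b] matters: in the
    iterated product [scale], [b] is the accumulator, whose length thus grows only additively. *)
Lemma size_bmul a b : size (bmul a b) <= size b + 2 * size a.
Proof.
rewrite /bmul foldl_rev; elim: a => //= x a IH.
by case: x; rewrite ?size_badd /=; lia.
Qed.

Section PtArith.
Context {A : Type} {eA : Enc A}.
Implicit Types f g : A -> seq bool.

Lemma pt_sub_run f g : pt f -> pt g -> pt (fun a => sub_run (f a) (g a)).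
Proof.
move=> pf pg; apply: (pt_comp2 _ pf pg) => /=.
apply: (pt_foldl_grow (step := fun _ => sub_step) (init := fun q => (false, q.2, [::]))
  (m := esize) (c := 1) (g := fun=> 6)) => //; try by pt_tac.
- by move=> s; lia.
- move=> a [[c b] acc] e; rewrite /sub_step !esize_pair esize_cons /=.
  have := esize_bool (~~ e && (head false b || c) || head false b && c).
  have := esize_bool (e (+) head false b (+) c); gt0 e; gt0 c.
  by case: b => [|y b] /=; rewrite ?esize_cons; lia.
- apply: (pb_le (h := fun q : seq bool * seq bool => esize q + 10)); last by pb_tac.
  move=> [q1 q2]; rewrite !esize_pair /=.
  by change (esize [::]) with 1; change (esize false) with 1; lia.
- exact: pb_cst.
- by rewrite /sub_step; pt_tac.
Qed.

Lemma pt_bsub f g : pt f -> pt g -> pt (fun a => bsub (f a) (g a)).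
Proof. by move=> pf pg; apply/pt_rev/pt_snd/pt_sub_run. Qed.

Lemma pt_blt f g : pt f -> pt g -> pt (fun a => blt (f a) (g a)).
Proof.
move=> pf pg; have H := pt_sub_run pf pg; rewrite /blt.
by pt_tac.
Qed.

Lemma pt_badd f g : pt f -> pt g -> pt (fun a => badd (f a) (g a)).
Proof.
move=> pf pg; apply: (pt_comp2 _ pf pg) => /=.
have H1 : pt (fun q : seq bool * seq bool => foldl add_step (false, q.2, [::]) q.1).
  apply: (pt_foldl_grow (step := fun _ => add_step) (init := fun q => (false, q.2, [::]))
    (m := esize) (c := 1) (g := fun=> 6)) => //; try by pt_tac.
  - by move=> s; lia.
  - move=> a [[c b] acc] e; rewrite /add_step !esize_pair esize_cons /=.
    have := esize_bool (e && (head false b || c) || head false b && c).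
    have := esize_bool (e (+) head false b (+) c); gt0 e; gt0 c.
    by case: b => [|y b] /=; rewrite ?esize_cons; lia.
  - apply: (pb_le (h := fun q : seq bool * seq bool => esize q + 10)); last by pb_tac.
    move=> [q1 q2]; rewrite !esize_pair /=.
    by change (esize [::]) with 1; change (esize false) with 1; lia.
  - exact: pb_cst.
  - by rewrite /add_step; pt_tac.
rewrite /badd.
have H2 : pt (fun r : bool * seq bool * seq bool => foldl carry_step (r.1.1, r.2) r.1.2).
  apply: (pt_foldl_grow (step := fun _ => carry_step) (init := fun r => (r.1.1, r.2))
    (m := esize) (c := 1) (g := fun=> 6)) => //; try by pt_tac.
  - by move=> s; lia.
  - move=> a [c acc] e; rewrite /carry_step !esize_pair esize_cons /=.
    have := esize_bool (c && e); have := esize_bool (c (+) e).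
    gt0 e; gt0 c; lia.
  - apply: (pb_le (h := fun r : bool * seq bool * seq bool => esize r)); last by pb_tac.
    by move=> [[c b] q]; rewrite !esize_pair /=; lia.
  - exact: pb_cst.
  - by rewrite /carry_step; pt_tac.
have H3 := pt_comp H2 H1.
by pt_tac.
Qed.

End PtArith.

Lemma pt_bmul A (eA : Enc A) (f g : A -> seq bool) : pt f -> pt g -> pt (fun a => bmul (f a) (g a)).
Proof.
move=> pf pg; apply: (pt_comp2 _ pf pg) => /=; rewrite /bmul.
pose step (q : seq bool * seq bool) acc (x : bool) :=
  if x then badd (false :: acc) q.2 else false :: acc.
apply: (pt_foldl (step := step) (init := fun=> [::]) (l := fun q => rev q.1)
  (M := fun q => 4 * (esize q.2 + 2 * esize q.1).+1)).
- by rewrite /step; apply: pt_if; [pt_tac | apply: pt_badd; pt_tac | pt_tac].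
- exact: pt_cst.
- by pt_tac.
- have [_ p1] : pt (fun q : seq bool * seq bool => q.1) by pt_tac.
  have [_ p2] : pt (fun q : seq bool * seq bool => q.2) by pt_tac.
  by pb_tac.
- move=> [a b] i; apply: leq_trans (esize_bits _) _; rewrite leq_mul2l ltnS /=.
  (* A partial run is itself a product, by the digits read so far, so [size_bmul] applies to it. *)
  have -> : take i (rev a) = rev (rev (take i (rev a))) by rewrite revK.
  apply: leq_trans (size_bmul (rev (take i (rev a))) b) _.
  rewrite leq_add ?size_le_esize // leq_mul2l /= size_rev.
  apply: leq_trans (size_le_esize a); rewrite size_take size_rev.
  by case: ltnP => // /ltnW.
Qed.

Ltac pt_user ::= match goal with
  | |- pt (fun x => bsub (@?f x) (@?g x)) => apply: pt_bsub
  | |- pt (fun x => badd (@?f x) (@?g x)) => apply: pt_badd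
  | |- pt (fun x => blt (@?f x) (@?g x)) => apply: pt_blt
  | |- pt (fun x => bmul (@?f x) (@?g x)) => apply: pt_bmul
  end.

(** * The algorithm *)

(* A residual arc: name of the arc it is a copy of, tail, head, reduced cost,
   and whether the copy carries flow (it is then stored reversed). *)
Local Notation res := (tree * (tree * (tree * (seq bool * bool))))%type.
Definition aid (e : res) : tree := e.1.
Definition src (e : res) : tree := e.2.1.
Definition dst (e : res) : tree := e.2.2.1.
Definition rcost (e : res) : seq bool := e.2.2.2.1.
Definition used (e : res) : bool := e.2.2.2.2.

Definition res0 : res := (Leaf, (Leaf, (Leaf, ([::], false)))).
(** Reversal should negate the reduced cost; it may be kept because only tree arcs, of reduced cost
    zero, are flipped. *)
Definition flip (e : res) : res := (aid e, (dst e, (src e, (rcost e, ~~ used e)))).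
Definition set_rc (e : res) c : res := (aid e, (src e, (dst e, (c, used e)))).
Definition cross (X : seq tree) (e : res) : bool := (src e \in X) && (dst e \notin X).

Definition select_step X (s : option res * seq res) (e : res) :=
  if cross X e then
    if s.1 is Some b
    then if blt (rcost e) (rcost b) then (Some e, b :: s.2) else (s.1, e :: s.2)
    else (Some e, s.2)
  else (s.1, e :: s.2).

(* A cheapest crossing arc, and all the other arcs. *)
Definition select X (r : seq res) := foldl (select_step X) (None, [::]) r.

(** The effect on reduced costs of raising the potential by [d] outside [X]; the potential itself is
    never computed. *)
Definition reprice (X : seq tree) (d : seq bool) (e : res) : res :=
  if cross X e then set_rc e (bsub (rcost e) d)
  else if (src e \notin X) && (dst e \in X) then set_rc e (badd (rcost e) d)
  else e.

(** [s.1] is the current vertex of the walk back from the target. One pass suffices: with the latest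
    arc first, the arc into a vertex precedes the arc into its parent. *)
Definition augment_step (s : tree * seq res) (e : res) :=
  if dst e == s.1 then (src e, flip e :: s.2) else (s.1, e :: s.2).

(* The flow units still to be sent (in unary), the reached vertices, the arcs
   of the search tree (latest first), and the remaining residual arcs. *)
Local Notation state := (seq tree * (seq tree * (seq res * seq res)))%type.

(** An augmentation returns all tree arcs to the pool and restarts the search. Otherwise the
    cheapest crossing arc joins the tree with reduced cost [[::]], that is zero; if none crosses,
    the state is final. *)
Definition flow_step (s t : tree) (st : state) : state :=
  if nilp st.1 then st
  else if t \in st.2.1 then
    (behead st.1, ([:: s], ([::], (foldl augment_step (t, st.2.2.2) st.2.2.1).2)))
  else
    let r := select st.2.1 st.2.2.2 in
    if r.1 is Some b
    then (st.1, (dst b :: st.2.1,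
           (set_rc b [::] :: st.2.2.1, map (reprice st.2.1 (rcost b)) r.2)))
    else st.

Definition push (T U : Type) (c : T) (v : seq U) (acc : seq T) :=
  foldl (fun s _ => c :: s) acc v.

(** Only the length matters: such lists serve as loop counters. *)
Definition unary_mul (U V : Type) (u : seq U) (v : seq V) : seq tree :=
  foldl (fun acc _ => push Leaf v acc) [::] u.

(** At most [size C] arcs join the tree before each augmentation, so [size K + 1] times [size C + 1]
    rounds are enough. *)
Definition flow_run (s t : tree) (K : seq tree) (C : seq res) : state :=
  foldl (fun st _ => flow_step s t st) (K, ([:: s], ([::], C)))
    (unary_mul (Leaf :: K) (res0 :: C)).

(** Parallel arcs may agree in all their data, so arcs are named by their positions, in unary. *)
Definition enumerate (E : Type) (l : seq E) : seq (tree * E) :=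
  rev (foldl (fun s e => (Node Leaf s.1, (s.1, e) :: s.2)) (Leaf, [::]) l).2.

(** The last [tree] of each type is the [Leaf] ending an [enc_seq], which makes the encodings agree
    literally with [enc_arc] and [enc_instance]. *)
Local Notation raw_arc := (tree * (tree * ((seq bool * seq bool) * (bool * tree))))%type.
Local Notation input := (tree * (seq raw_arc * (tree * (tree * (seq bool * tree)))))%type.

(* Multiplying each weight by the denominators of all the others makes them
   integral. *)
Definition scale (l : seq (tree * raw_arc)) (a : tree * raw_arc) : seq bool :=
  foldl (fun acc b => if b.1 == a.1 then acc else bmul b.2.2.2.1.2 acc)
    a.2.2.2.1.1 l.

Definition new_res (l : seq (tree * raw_arc)) (a : tree * raw_arc) : res :=
  (a.1, (a.2.1, (a.2.2.1, (scale l a, false)))).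

Definition copies (u : seq tree) (l : seq (tree * raw_arc)) : seq res :=
  foldl (fun acc r => push r.1 (if r.2 then u else Leaf :: u) acc) [::]
    [seq (new_res l a, a.2.2.2.2.1) | a <- l].

Definition unary_step (s : seq bool * seq tree) :=
  if has id s.1 then (bsub s.1 [:: true], Leaf :: s.2) else s.

(** Counts [b] down at most once per arc; a nonzero remainder shows that [b] exceeds the number of
    arcs. *)
Definition to_unary (b : seq bool) (l : seq raw_arc) :=
  foldl (fun s _ => unary_step s) (b, [::]) l.

Definition ftf_flow (s t : tree) (u : seq tree) (l : seq (tree * raw_arc)) :
    option (seq bool) :=
  let fin := flow_run s t (unary_mul u (Leaf :: u)) (copies u l) in
  if nilp fin.1
  then Some [seq has (fun e => (aid e == a.1) && used e) fin.2.2.1 ||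
                 has (fun e => (aid e == a.1) && used e) fin.2.2.2 | a <- l]
  else None.

(** In the first branch the empty set is optimal: either empty paths join the source to itself, or
    no arc can fail and feasibility is vacuous. *)
Definition ftf_alg (x : input) : option (seq bool) :=
  if (x.2.2.1 == x.2.2.2.1) || ~~ has (fun a : raw_arc => a.2.2.2.1) x.2.1
  then Some [seq false | a <- x.2.1]
  else
    let q := to_unary x.2.2.2.2.1 x.2.1 in
    if has id q.1 then None
    else ftf_flow x.2.2.1 x.2.2.2.1 q.2 (enumerate x.2.1).

(** * Running time *)

Ltac res_unfold := rewrite /new_res /reprice /cross /set_rc /flip /aid /src /dst /rcost /used.

Lemma esize_some T (eT : Enc T) (x : T) : esize (Some x) = (esize x).+2.
Proof. by []. Qed.

Lemma pt_select A (eA : Enc A) (X : A -> seq tree) (r : A -> seq res) :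
  pt X -> pt r -> pt (fun a => select (X a) (r a)).
Proof.
move=> pX pr; apply: (pt_comp2 _ pX pr).
apply: (pt_foldl_grow (step := fun q => select_step q.1)
  (init := fun=> (None, [::])) (m := esize) (c := 1) (g := fun=> 2)).
- by move=> s; lia.
- move=> a [[b|] s] e; rewrite /select_step /=; gt0 e;
    do ?case: ifP => _; rewrite ![esize (_, _)]esize_pair ?esize_cons ?esize_some /=; try lia.
  by change (esize None) with 1; lia.
- exact: pb_cst.
- exact: pb_cst.
- rewrite /select_step; apply: pt_if; [by res_unfold; pt_tac| |by pt_tac].
  apply: (pt_option res0
    (f := fun q => q.2.1.1)
    (g := fun q b => if blt (rcost q.2.2) (rcost b) then (Some q.2.2, b :: q.2.1.2)
       else (q.2.1.1, q.2.2 :: q.2.1.2))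
    (h := fun q => (Some q.2.2, q.2.1.2))); [by pt_tac|by res_unfold; pt_tac|by pt_tac].
- by pt_tac.
- by pt_tac.
Qed.

Lemma pt_augment A (eA : Enc A) (t : A -> tree) (r q : A -> seq res) :
  pt t -> pt r -> pt q -> pt (fun a => foldl augment_step (t a, r a) (q a)).
Proof.
move=> p1 p2 p3; have ps : pt (fun a => (t a, r a)) by pt_tac.
apply: (pt_foldl_grow (step := fun=> augment_step)
  (m := esize) (c := 1) (g := fun=> 5)) => //.
- by move=> s; lia.
- move=> a [c s] [i [x [y [w u]]]].
  rewrite /augment_step /flip /aid /src /dst /rcost /used /=.
  have := esize_bool (~~ u).
  case: ifP => _; rewrite !esize_pair ?esize_cons !esize_pair /=; lia.
- by have [_ p] := ps.
- exact: pb_cst.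
- by rewrite /augment_step; res_unfold; pt_tac.
Qed.

Lemma pt_flow_step A (eA : Enc A) (s t : A -> tree) (st : A -> state) :
  pt s -> pt t -> pt st -> pt (fun a => flow_step (s a) (t a) (st a)).
Proof.
move=> p1 p2 p3; apply: (pt_comp3 _ p1 p2 p3) => /=; clear.
rewrite /flow_step; apply: pt_if; [by pt_tac|by pt_tac|].
apply: pt_if; first by pt_tac.
  by pt_tac; apply: pt_augment; pt_tac.
pose X (q : tree * (tree * state)) := q.2.2.2.1.
apply: (pt_option res0
    (f := fun q => (select (X q) q.2.2.2.2.2).1)
    (g := fun q b => (q.2.2.1, (dst b :: X q,
           (set_rc b [::] :: q.2.2.2.2.1,
            map (reprice (X q) (rcost b)) (select (X q) q.2.2.2.2.2).2)))));
  rewrite /X; [by pt_tac; apply: pt_select; pt_tac| |by pt_tac].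
res_unfold; pt_tac.
by apply: pt_select; pt_tac.
Qed.

Lemma pt_push A T U (eA : Enc A) (eT : Enc T) (eU : Enc U) (c : A -> T)
    (v : A -> seq U) (acc : A -> seq T) :
  pt c -> pt v -> pt acc -> pt (fun a => push (c a) (v a) (acc a)).
Proof.
move=> p1 p2 p3; apply: (pt_foldl_grow (step := fun a s _ => c a :: s)
  (m := esize) (c := 1) (g := fun a => (esize (c a)).+1)) => //.
- by move=> s; lia.
- by move=> a s e; rewrite esize_cons; gt0 e; nia.
- by have [_ p] := p3.
- by have [_ p] := p1; pb_tac.
- by pt_tac; apply: pt_comp p1 _; pt_tac.
Qed.

Lemma esize_push T U (eT : Enc T) (c : T) (v : seq U) acc :
  esize (push c v acc) = size v * (esize c).+1 + esize acc.
Proof. by elim: v acc => //= x v IH acc; rewrite IH esize_cons; lia. Qed.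

Lemma push_nseq T U (c : T) (v : seq U) acc : push c v acc = nseq (size v) c ++ acc.
Proof.
by elim: v acc => //= x v IH acc; rewrite IH; elim: (size v) => //= n ->.
Qed.

Lemma pt_unary_mul A U V (eA : Enc A) (eU : Enc U) (eV : Enc V) (u : A -> seq U)
    (v : A -> seq V) :
  pt u -> pt v -> pt (fun a => unary_mul (u a) (v a)).
Proof.
move=> p1 p2; apply: (pt_foldl_grow (step := fun a acc _ => push Leaf (v a) acc)
  (init := fun=> [::]) (m := esize) (c := 1) (g := fun a => 2 * esize (v a))) => //.
- by move=> s; lia.
- move=> a s e; rewrite esize_push; gt0 e; pose proof (size_le_esize (v a)).
  by change (esize Leaf) with 1; nia.
- exact: pb_cst.
- by have [_ p] := p2; pb_tac.
- apply: pt_push; [by pt_tac| |by pt_tac].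
  by apply: pt_comp p2 _; pt_tac.
- exact: pt_cst.
Qed.

Lemma size_unary_mul U V (u : seq U) (v : seq V) : size (unary_mul u v) = size u * size v.
Proof.
rewrite /unary_mul -[RHS]addn0 -[in RHS](_ : size (Nil tree) = 0) //.
elim: u [::] => //= x u IH acc; rewrite IH push_nseq size_cat size_nseq; lia.
Qed.

Definition res_bounded (B L : nat) (e : res) : bool :=
  [&& esize (aid e) <= B, esize (src e) <= B, esize (dst e) <= B & size (rcost e) <= L].

(** Here [i] counts rounds. A sum is one digit longer than its longer summand, so the common bound
    [B + i] on the lengths of all reduced costs is preserved. *)
Definition state_bounded (B i : nat) (st : state) : bool :=
  [&& esize st.1 <= B, all (fun x => esize x <= B) st.2.1, size st.2.1 <= i.+1,
      all (res_bounded B (B + i)) st.2.2.1, all (res_bounded B (B + i)) st.2.2.2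
    & size st.2.2.1 + size st.2.2.2 <= B].

Lemma res_boundedW B L L' e : L <= L' -> res_bounded B L e -> res_bounded B L' e.
Proof. by rewrite /res_bounded => le /and4P[-> -> -> h] /=; lia. Qed.

Lemma res_bounded_esize B L e : res_bounded B L e -> esize e <= 3 * B + 4 * L + 11.
Proof.
case/and4P; rewrite !esize_pair /aid /src /dst /rcost.
by have := esize_bool e.2.2.2.2; have := esize_bits e.2.2.2.1; lia.
Qed.

Lemma select_all X (p : pred res) r :
  all p r -> oapp p true (select X r).1 && all p (select X r).2.
Proof.
pose z : option res * seq res := (None, [::]); rewrite /select -/z.
have : oapp p true z.1 && all p z.2 by [].
elim: r z => [|e r IH] [o s] Hs /=; first by move=> _.
case/andP=> pe pr; apply: IH => //.
rewrite /select_step /=; case: ifP => _; last by move: Hs => /= /andP[-> ->]; rewrite pe.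
case: o Hs => [b|] /= => [/andP[h1 h2]|h2]; last by rewrite pe.
by case: ifP => _ /=; rewrite ?pe ?h1 ?h2.
Qed.

Lemma select_size X r :
  (select X r).1 + size (select X r).2 = size r.
Proof.
pose z : option res * seq res := (None, [::]); rewrite /select -/z.
have -> : size r = z.1 + size z.2 + size r by [].
elim: r z => [|e r IH] [o s] /=; first by rewrite addn0.
rewrite IH /select_step /=; case: ifP => _ /=; last by lia.
by case: o => [b|] /=; [case: ifP => _ /=|]; lia.
Qed.

Lemma augment_all (p : pred res) c s q :
  all p s -> all (fun e => p e && p (flip e)) q ->
  all p (foldl augment_step (c, s) q).2.
Proof.
elim: q c s => //= e q IH c s ps /andP[/andP[p1 p2] pq].
by rewrite {2}/augment_step /=; case: ifP => _; apply: IH; rewrite //= ?p1 ?p2.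
Qed.

Lemma augment_count (p : pred res) c s q : (forall e, p (flip e) = p e) ->
  count p (foldl augment_step (c, s) q).2 = count p q + count p s.
Proof.
move=> Hp; elim: q c s => //= e q IH c s.
by rewrite {2}/augment_step /=; case: ifP => _; rewrite IH /= ?Hp; lia.
Qed.

Lemma flow_step_bounded B i s t st : esize s <= B ->
  state_bounded B i st -> state_bounded B i.+1 (flow_step s t st).
Proof.
move=> sB /and5P[h1 h2 h3 h4 /andP[h5 h6]].
have W : forall l, all (res_bounded B (B + i)) l -> all (res_bounded B (B + i.+1)) l.
  by move=> l; apply: sub_all => e; apply: res_boundedW; lia.
have keep : state_bounded B i.+1 st.
  by rewrite /state_bounded h1 h2 !W // h6 /=; lia.
rewrite /flow_step; case: ifP => // _; case: ifP => _.
  apply/and5P; split => //=; last apply/andP; try split.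
  - by case: (st.1) h1 => //= x k; rewrite esize_cons; lia.
  - by rewrite sB.
  - apply/W/augment_all => //; apply: sub_all h4 => e he; rewrite he /=.
    by move: he => /and4P[? ? ? ?]; apply/and4P; split.
  - rewrite -!count_predT in h6 *; rewrite augment_count //.
have /= := select_all st.2.1 h5; have := select_size st.2.1 st.2.2.2.
case: (select _ _) => [[b|] r] //= Es /andP[/and4P[b1 b2 b3 b4] hr].
apply/and5P; split => //=; last apply/andP; try split.
- by rewrite h2 b3.
- by rewrite W // andbT; apply/and4P; split.
- rewrite all_map; apply: sub_all hr => e; rewrite /= /reprice => he.
  have he' := res_boundedW (leq_addr 1 (B + i)) he; rewrite addn1 -addnS in he'.
  move: he => /and4P[e1 e2 e3 e4].
  case: ifP => _.
    apply/and4P; split; rewrite //= /rcost /= size_bsub.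
    by move: e4; rewrite /rcost; lia.
  case: ifP => _ //; apply/and4P; split; rewrite //= /rcost /= size_badd /rcost.
  by move: b4 e4; rewrite /rcost; lia.
- by rewrite size_map; lia.
Qed.

Lemma pt_flow_run A (eA : Enc A) (s t : A -> tree) (K : A -> seq tree) (C : A -> seq res) :
  pt s -> pt t -> pt K -> pt C -> pt (fun a => flow_run (s a) (t a) (K a) (C a)).
Proof.
move=> ps pt' pK pC.
have pm : pt (fun a => unary_mul (Leaf :: K a) (res0 :: C a)).
  by apply: pt_unary_mul; pt_tac.
pose (B := fun a => esize (s a) + esize (K a) + esize (C a) +
  esize (unary_mul (Leaf :: K a) (res0 :: C a))).
have pB : pb B by move: ps pK pC pm => [_ ?] [_ ?] [_ ?] [_ ?]; rewrite /B; pb_tac.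
apply: (pt_foldl (step := fun a st _ => flow_step (s a) (t a) st)
  (init := fun a => (K a, ([:: s a], ([::], C a))))
  (M := fun a => 30 * ((B a).+1 * (B a).+1) + 30)) => //.
- apply: pt_flow_step; try by pt_tac.
  + by apply: pt_comp ps _; pt_tac.
  + by apply: pt_comp pt' _; pt_tac.
- by pt_tac.
- by pb_tac.
move=> a i; set st0 := (K a, _); set l := unary_mul _ _.
have H0 : state_bounded (B a) 0 st0.
  pose proof (all_esize (C a)) as HC; pose proof (size_le_esize (C a)).
  apply/and5P; split; rewrite //= ?andbT; try by rewrite /B; lia.
  rewrite (leq_trans (n := esize (C a))) //; last by rewrite /B; lia.
  rewrite andbT; apply: sub_all HC => e he.
  have : esize e <= B a by rewrite /B; lia.
  pose proof (size_le_esize (rcost e)) as h.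
  rewrite !esize_pair => he'; apply/and4P.
  by split; move: h he'; rewrite ?addn0; rewrite /aid /src /dst /rcost; lia.
have H : forall (r : seq tree) st j, state_bounded (B a) j st ->
    state_bounded (B a) (j + size r) (foldl (fun st _ => flow_step (s a) (t a) st) st r).
  elim=> [|x r IH] st j hj /=; first by rewrite addn0.
  by rewrite addnS -addSn; apply/IH/flow_step_bounded => //; rewrite /B; lia.
have := H (take i l) st0 0 H0; set st := foldl _ _ _; rewrite add0n.
set j := size _; have lj : j <= B a.
  rewrite /j /B size_take; pose proof (size_le_esize l); move: (size l) H1 => n.
  by rewrite -/l; case: ltnP; lia.
case/and5P=> h1 h2 h3 h4 /andP[h5 h6].
(* [res_bounded_esize] with [B + j] digits and [j <= B] gives 3B + 8B + 11. *)
have le L : all (res_bounded (B a) (B a + j)) L -> esize L <= (size L * (11 * B a + 11).+1).+1.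
  move=> HL; apply: esize_seq_le; apply: sub_all HL => e /res_bounded_esize; lia.
have := le _ h4; have := le _ h5; have := esize_seq_le h2.
by rewrite !esize_pair; clear -h1 h3 lj h6; nia.
Qed.

Definition unary (i : nat) : tree := iter i (Node Leaf) Leaf.

Lemma enumerate_foldl E (l : seq E) i acc :
  foldl (fun s e => (Node Leaf s.1, (s.1, e) :: s.2)) (unary i, acc) l =
  (unary (i + size l), rev (zip (map unary (iota i (size l))) l) ++ acc).
Proof.
elim: l i acc => [|e l IH] i acc /=; first by rewrite addn0.
by rewrite -[Node _ _]/(unary i.+1) IH /= addnS rev_cons cat_rcons.
Qed.

Lemma enumerateE E (l : seq E) : enumerate l = zip (map unary (iota 0 (size l))) l.
Proof. by rewrite /enumerate (enumerate_foldl l 0) cats0 revK. Qed.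

Lemma esize_unary i : esize (unary i) = i.*2.+1.
Proof.
elim: i => //= i IH.
by rewrite (_ : esize (Node Leaf (unary i)) = (1 + esize (unary i)).+1) // IH; lia.
Qed.

Lemma enumerate_bound E (eE : Enc E) (r : seq E) k L :
  all (fun e => esize e <= L) r -> k + size r <= L ->
  all (fun p : tree * E => esize p <= 4 * L) (zip (map unary (iota k (size r))) r).
Proof.
elim: r k => //= e r IH k /andP[he hr] hk; rewrite IH ?andbT //; last by lia.
by rewrite esize_pair /= esize_unary; lia.
Qed.

Lemma pt_enumerate A E (eA : Enc A) (eE : Enc E) (l : A -> seq E) :
  pt l -> pt (fun a => enumerate (l a)).
Proof.
move=> pl; apply/pt_rev/pt_snd.
have [_ pbl] := pl.
apply: (pt_foldl (step := fun _ s e => (Node Leaf s.1, (s.1, e) :: s.2))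
  (init := fun=> (Leaf, [::])) (M := fun a => 20 * (esize (l a) * esize (l a)) + 20)) => //.
- by pt_tac.
- by pt_tac.
- by pb_tac.
move=> a i; rewrite (enumerate_foldl _ 0) cats0 add0n esize_pair esize_rev /= esize_unary.
set m := size _; have lm : m <= esize (l a).
  pose proof (size_le_esize (l a)); rewrite /m size_take; case: ltnP; lia.
set z := zip _ _.
have sz : size z = m by rewrite size_zip size_map size_iota minnn.
have H : all (fun p : tree * E => esize p <= 4 * esize (l a)) z.
  pose proof (all_esize (l a)) as Ha; rewrite -{2}(cat_take_drop i (l a)) all_cat in Ha.
  case/andP: Ha => Ha _; rewrite /z.
  exact: enumerate_bound.
apply: leq_ltn_trans (leq_add (leqnn _) (esize_seq_le H)) _.
by rewrite sz; clear -lm; nia.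
Qed.

Lemma pt_scale A (eA : Enc A) (l : A -> seq (tree * raw_arc)) (b : A -> tree * raw_arc) :
  pt l -> pt b -> pt (fun a => scale (l a) (b a)).
Proof.
move=> pl pb'; apply: (pt_comp2 _ pl pb'); clear.
apply: (pt_foldl_grow (step := fun q acc b => if b.1 == q.2.1 then acc else bmul b.2.2.2.1.2 acc)
  (init := fun q => q.2.2.2.2.1.1) (m := size) (c := 4) (g := fun=> 2)).
- exact: esize_bits.
- move=> a s e; case: ifP => _; first by lia.
  apply: leq_trans (size_bmul _ _) _; rewrite leq_add2l leq_mul2l /=.
  apply: leq_trans (size_le_esize _) _; rewrite !esize_pair; lia.
- have [_ p] : pt (fun q : seq (tree * raw_arc) * (tree * raw_arc) => q.2.2.2.2.1.1) by pt_tac.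
  by apply: pb_le p => q; exact: size_le_esize.
- exact: pb_cst.
- by pt_tac.
- by pt_tac.
- by pt_tac.
Qed.

Lemma pt_copies A (eA : Enc A) (u : A -> seq tree) (l : A -> seq (tree * raw_arc)) :
  pt u -> pt l -> pt (fun a => copies (u a) (l a)).
Proof.
move=> pu pl; have [_ pbu] := pu.
apply: (pt_foldl_grow (step := fun a acc r => push r.1 (if r.2 then u a else Leaf :: u a) acc)
  (init := fun=> [::]) (m := esize) (c := 1) (g := fun a => 2 * (esize (u a)).+1)).
- by move=> s; lia.
- move=> a s [e b]; rewrite esize_push [esize (e, b)]esize_pair /=.
  pose proof (size_le_esize (u a)) as hu.
  have lv : size (if b then u a else Leaf :: u a) <= (esize (u a)).+1.
    by case: (b) => //; exact: leqW.
  rewrite addnC leq_add2l; apply: leq_trans (leq_mul lv (leqnn _)) _.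
  by rewrite -mulnA mulnCA leq_mul2l; lia.
- exact: pb_cst.
- by pb_tac.
- apply: pt_push; try by pt_tac.
  have H : pt (fun q : A * (seq res * (res * bool)) => u q.1) by apply: pt_comp pu _; pt_tac.
  by apply: pt_if; pt_tac.
- exact: pt_cst.
- apply: pt_map => //; res_unfold; pt_tac.
  by apply: pt_scale; [apply: pt_comp pl _|]; pt_tac.
Qed.

Lemma pt_to_unary A (eA : Enc A) (b : A -> seq bool) (l : A -> seq raw_arc) :
  pt b -> pt l -> pt (fun a => to_unary (b a) (l a)).
Proof.
move=> pb' pl; have [_ pbb] := pb'.
apply: (pt_foldl_grow (step := fun _ s _ => unary_step s) (init := fun a => (b a, [::]))
  (m := fun s => 4 * size s.1 + esize s.2) (c := 6) (g := fun=> 2)).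
- by move=> [x y]; rewrite esize_pair /=; have := esize_bits x; lia.
- move=> a [x y] e; rewrite /unary_step; gt0 e; case: ifP => _ /=; last by lia.
  by rewrite size_bsub esize_cons; change (esize Leaf) with 1; lia.
- apply: (pb_le (h := fun a => 4 * esize (b a) + 1)); last by pb_tac.
  by move=> a /=; rewrite leq_add2r leq_mul2l /= size_le_esize.
- exact: pb_cst.
- by rewrite /unary_step; pt_tac.
- by pt_tac.
- by [].
Qed.

Lemma pt_ftf_flow A (eA : Enc A) (s t : A -> tree) (u : A -> seq tree)
    (l : A -> seq (tree * raw_arc)) :
  pt s -> pt t -> pt u -> pt l -> pt (fun a => ftf_flow (s a) (t a) (u a) (l a)).
Proof.
move=> ps pt' pu pl.
have H : pt (fun a => flow_run (s a) (t a) (unary_mul (u a) (Leaf :: u a)) (copies (u a) (l a))).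
  apply: pt_flow_run => //; last exact: pt_copies.
  by apply: pt_unary_mul; pt_tac.
pose F (q : state * seq (tree * raw_arc)) := if nilp q.1.1
  then Some [seq has (fun e => (aid e == a.1) && used e) q.1.2.2.1 ||
                 has (fun e => (aid e == a.1) && used e) q.1.2.2.2 | a : tree * raw_arc <- q.2]
  else None.
apply: (pt_comp (g := F) _ (pt_pair H pl)).
by rewrite /F; apply: pt_if; res_unfold; pt_tac.
Qed.

Lemma pt_ftf_alg : pt ftf_alg.
Proof.
rewrite /ftf_alg; apply: pt_if; [by pt_tac|by pt_tac|].
have H : pt (fun x : input => to_unary x.2.2.2.2.1 x.2.1) by apply: pt_to_unary; pt_tac.
apply: pt_if; [by pt_tac|by pt_tac|].
by apply: pt_ftf_flow; pt_tac; apply: pt_enumerate; pt_tac.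
Qed.

(** * Correctness of the flow computation *)

Definition select_inv X (q : seq res) (z : option res * seq res) : Prop :=
  if z.1 is Some b then
    [/\ perm_eq (b :: z.2) q, cross X b
      & all (fun e => cross X e ==> (bval (rcost b) <= bval (rcost e))) q]
  else all (fun e => ~~ cross X e) q /\ perm_eq z.2 q.

Lemma select_invP X r : select_inv X (rev r) (select X r).
Proof.
rewrite /select /rev; have : select_inv X [::] (None, [::]) by [].
elim: r [::] (None, [::]) => //= e r IH q z Hz; apply: IH.
rewrite /select_step; case: z Hz => [[b|] z] /=.
- case=> /= Hp cb /allP Hm; case: ifPn => ce; last first.
    split=> //=; last by rewrite (negbTE ce); apply/allP.
    rewrite -(perm_cons e) in Hp; rewrite (perm_trans _ Hp) //.
  by apply/permEl; exact: (perm_catCA [:: b] [:: e] z).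
  rewrite bltE; case: ltnP => lt.
    split=> //=; first by rewrite perm_cons.
    rewrite ce /= leqnn /=; apply/allP => e' /Hm.
    by case: cross => //= h; apply: leq_trans h; exact: ltnW.
  split=> //=; last by rewrite ce lt; apply/allP.
  rewrite -(perm_cons e) in Hp; rewrite (perm_trans _ Hp) //.
  by apply/permEl; exact: (perm_catCA [:: b] [:: e] z).
- case=> /= Hn Hp; case: ifPn => ce /=; last by split=> /=; rewrite ?ce ?perm_cons.
  split=> //=; first by rewrite perm_cons.
  rewrite ce leqnn /=; apply: sub_all Hn => e' /negbTE->//.
Qed.

Section FlowCorrectness.
Local Open Scope ring_scope.

Variables (A : finType) (name : A -> tree) (o : tree -> A) (tl hd : A -> tree) (w cap : A -> nat).
Variables (s t : tree).
Implicit Types (p : tree -> int) (e : res) (l q r : seq res) (st : state).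

(* Quantifying over all potentials [p] packages flow conservation and the
   value [K] in one equation. *)
Definition is_flow (g : A -> nat) (K : nat) : Prop :=
  forall p, \sum_a (g a)%:Z * (p (hd a) - p (tl a)) = K%:Z * (p t - p s).

Definition oriented e : bool :=
  [&& src e == (if used e then hd else tl) (o (aid e)),
      dst e == (if used e then tl else hd) (o (aid e)) & aid e == name (o (aid e))].

(** The left side is a natural number, so this includes dual feasibility of the potential [p]. *)
Definition priced p e : bool :=
  (bval (rcost e))%:Z ==
  (if used e then - (w (o (aid e)))%:Z else (w (o (aid e)))%:Z) + p (src e) - p (dst e).

(** Used copies are stored reversed, so this is the left side of [is_flow] for the current flow. *)
Definition excess p l : int := \sum_(e <- l | used e) (p (src e) - p (dst e)).

(** Vertices and arcs are listed in step, latest first: each arc enters the vertex at its own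
    position from a vertex reached earlier. *)
Fixpoint search_tree (X : seq tree) q {struct q} : bool :=
  if q is e :: q' then
    if X is x :: X' then
      [&& dst e == x, src e \in X', x \notin X' & search_tree X' q']
    else false
  else X == [:: s].

Record flow_inv (K : nat) st : Prop := FlowInv {
  inv_count : forall a, count (fun e => o (aid e) == a) (st.2.2.1 ++ st.2.2.2) = cap a;
  inv_oriented : all oriented (st.2.2.1 ++ st.2.2.2);
  inv_priced : exists p, all (priced p) (st.2.2.1 ++ st.2.2.2);
  inv_tight : all (fun e => bval (rcost e) == 0%N) st.2.2.1;
  inv_size : (size st.1 <= K)%N;
  inv_excess : forall p,
    excess p st.2.2.1 + excess p st.2.2.2 = (K%:Z - (size st.1)%:Z) * (p t - p s);
  inv_tree : search_tree st.2.1 st.2.2.1 }.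

Lemma excess_cons p e l :
  excess p (e :: l) = (if used e then p (src e) - p (dst e) else 0) + excess p l.
Proof. by rewrite /excess big_cons; case: ifP; rewrite ?add0r. Qed.

Lemma excess_flip p e l :
  excess p (flip e :: l) = excess p (e :: l) + (p (dst e) - p (src e)).
Proof.
rewrite !excess_cons /flip /used /src /dst /=.
by case: (e.2.2.2.2) => /=; lia.
Qed.

(** The contributions of the flipped arcs telescope along the tree path from [s] to [c]. *)
Lemma augment_excess p X q c r : search_tree X q -> c \in X ->
  excess p (foldl augment_step (c, r) q).2 = excess p q + excess p r + (p c - p s).
Proof.
elim: q X c r => [|e q IH] X c r /=.
  by move=> /eqP-> /[!inE] /eqP->; rewrite /excess big_nil; lia.
case: X => // x X /and4P[/eqP dx sX nx ST]; rewrite in_cons => cX.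
rewrite {2}/augment_step /= dx; case: eqP => [<-|/eqP ne].
  rewrite (IH _ _ _ ST sX) excess_flip !excess_cons dx; lia.
have cX' : c \in X by case/orP: cX ne => // /eqP->; rewrite eqxx.
by rewrite (IH _ _ _ ST cX') !excess_cons; lia.
Qed.

Lemma search_tree_inside X q : search_tree X q ->
  all (fun e => (src e \in X) && (dst e \in X)) q && (s \in X).
Proof.
elim: q X => [|e q IH] X /=; first by move/eqP->; rewrite inE eqxx.
case: X => // x X /and4P[/eqP-> sX nx /IH/andP[H sX']].
rewrite !in_cons eqxx sX sX' !orbT /= andbT; apply: sub_all H => e' /andP[h1 h2].
by rewrite !in_cons h1 h2 !orbT.
Qed.

Lemma excess_perm p l l' : perm_eq l l' -> excess p l = excess p l'.
Proof. by move=> h; apply: perm_big. Qed.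

Lemma reprice_fields X d e :
  [/\ aid (reprice X d e) = aid e, src (reprice X d e) = src e,
      dst (reprice X d e) = dst e & used (reprice X d e) = used e].
Proof. by rewrite /reprice; case: ifP => _ //; case: ifP. Qed.

Lemma excess_reprice p X d l : excess p (map (reprice X d) l) = excess p l.
Proof.
rewrite /excess big_map; apply: eq_big => [e|e _].
  by have [_ _ _ ->] := reprice_fields X d e.
by have [_ -> -> _] := reprice_fields X d e.
Qed.

Lemma oriented_reprice X d e : oriented (reprice X d e) = oriented e.
Proof. by rewrite /oriented; have [-> -> -> ->] := reprice_fields X d e. Qed.

Lemma oriented_flip e : oriented (flip e) = oriented e.
Proof.
rewrite /oriented /flip /src /dst /used /aid /=; case: (e.2.2.2.2) => /=; exact: andbCA.
Qed.

(** Minimality of [d] among the crossing arcs makes the truncated subtraction exact. *)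
Lemma priced_reprice p X d e (p' := fun v => p v + (if v \in X then 0 else (bval d)%:Z)) :
  cross X e ==> (bval d <= bval (rcost e))%N ->
  priced p e -> priced p' (reprice X d e).
Proof.
rewrite /priced /p'; have [-> -> -> ->] := reprice_fields X d e.
rewrite /reprice /cross; move: (if used e then _ else _) => c.
case: (src e \in X); case: (dst e \in X) => /= le /eqP E.
- by rewrite E; lia.
- by rewrite /set_rc /rcost /= bsubE //; move: E le; rewrite /rcost; lia.
- by rewrite /set_rc /rcost /= baddE //; move: E le; rewrite /rcost; lia.
- by rewrite E; lia.
Qed.

Lemma priced_flip p e : bval (rcost e) == 0%N -> priced p e -> priced p (flip e).
Proof.
rewrite /priced /flip /rcost /used /src /dst /aid /= => /eqP->.
by case: (e.2.2.2.2) => /= /eqP; lia.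
Qed.

Lemma flow_step_inv K st : flow_inv K st -> flow_inv K (flow_step s t st).
Proof.
case: st => [k [X [T R]]] I; rewrite /flow_step /=.
case: k I => [|k0 k] I //=; case: ifP => tX.
  have [/= Hc Ho [p Hp] Ht Hs He Htree] := I.
  move: Ho Hp; rewrite !all_cat => /andP[HoT HoR] /andP[HpT HpR].
  split=> /=.
  - by move=> a; rewrite augment_count // -count_cat.
  - apply: augment_all => //; apply: sub_all HoT => e he.
    by rewrite oriented_flip he.
  - exists p; apply: augment_all => //; apply/allP => e eT.
    by rewrite priced_flip (allP HpT, allP Ht).
  - by [].
  - exact: ltnW.
  - move=> q; rewrite (augment_excess _ _ Htree tX) He /excess big_nil; lia.
  - by [].
have := select_invP X R; case: (select X R) => [[b|] r] //= [Hp cb Hm].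
have {}Hp : perm_eq (b :: r) R by rewrite (perm_trans Hp) // perm_rev.
have {}Hm : all (fun e => cross X e ==> (bval (rcost b) <= bval (rcost e))%N) (b :: r).
  by rewrite (perm_all _ Hp) -all_rev.
have [/= Hc Ho [p Hpr] Ht Hs He Htree] := I.
move: Ho Hpr; rewrite !all_cat -!(perm_all _ Hp) /= => /and3P[HoT Hob HoR] /and3P[HpT Hpb HpR].
case/andP: Hm => _ /allP Hm.
split=> //=.
- move=> a; rewrite -Hc !count_cat -(permP Hp) /= count_map.
  have -> : count (preim (reprice X (rcost b)) (fun e => o (aid e) == a)) r =
            count (fun e => o (aid e) == a) r.
    by apply: eq_count => e /=; have [-> _ _ _] := reprice_fields X (rcost b) e.
  exact: addnCA.
- rewrite all_cat HoT all_map.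
  have -> : oriented (set_rc b [::]) = oriented b by [].
  by rewrite Hob /=; apply: sub_all HoR => e /=; rewrite oriented_reprice.
(* The shift makes [b] tight and leaves tree arcs alone, as both their ends lie in [X]. *)
- pose p' := fun v => p v + (if v \in X then 0 else (bval (rcost b))%:Z).
  exists p'; rewrite all_cat all_map.
  have /andP[Hin _] := search_tree_inside Htree.
  apply/and3P; split.
  + move: Hpb cb; rewrite /priced /cross /p' /set_rc /rcost /used /src /dst /aid /=.
    by move=> /eqP E /andP[-> /negbTE->]; apply/eqP; clear -E; lia.
  + apply/allP => e eT; have := allP HpT e eT; have /andP[h1 h2] := allP Hin e eT.
    by rewrite /priced /p' h1 h2 !addr0.
  + by apply/allP => e er; apply: priced_reprice; [exact: Hm | exact: (allP HpR)].
- move=> q; rewrite -He excess_reprice -(excess_perm q Hp) !excess_cons.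
  exact: etrans (esym (addrA _ _ _)) (addrCA _ _ _).
- by case/andP: cb => -> ->; rewrite eqxx.
Qed.

Definition flow_done st : bool :=
  nilp st.1 || (t \notin st.2.1) && all (fun e => ~~ cross st.2.1 e) st.2.2.2.

(** The total number of residual arcs is constant. Growing the tree takes one arc from the pool; an
    augmentation refills the pool but saves a unit, which is weighted above all arcs together. *)
Definition flow_measure st : nat :=
  (size st.1 * (size st.2.2.1 + size st.2.2.2).+1 + size st.2.2.2)%N.

Lemma flow_done_step st : flow_done st -> flow_step s t st = st.
Proof.
rewrite /flow_step /flow_done; case: nilp => //= /andP[/negbTE-> /allP H].
have := select_invP st.2.1 st.2.2.2.
case: select => [[b|] r] //= [Hp cb _].
have : b \in st.2.2.2 by rewrite -mem_rev -(perm_mem Hp) mem_head.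
by move/H; rewrite cb.
Qed.

Lemma flow_step_measure st :
  flow_done st \/ (flow_measure (flow_step s t st) < flow_measure st)%N.
Proof.
case: st => [k [X [T R]]]; rewrite /flow_done /flow_step /flow_measure /=.
case: k => [|x k] /=; first by left.
case: ifP => tX /=.
  by right; rewrite -!count_predT augment_count // add0n !count_predT; nia.
have := select_invP X R; case: select => [[b|] r] /=.
  case=> Hp _ _; right; have := perm_size Hp; rewrite size_rev size_map /= => <-; nia.
by case=> H _; left; rewrite -all_rev.
Qed.

Lemma flow_fold_done (z : seq tree) st : (flow_measure st < size z)%N ->
  flow_done (foldl (fun st _ => flow_step s t st) st z).
Proof.
elim: z st => //= x z IH st lt.
have [D|lt'] := flow_step_measure st; last by apply: IH; lia.
rewrite flow_done_step //; elim: z {IH lt} => //= y z IH; rewrite flow_done_step //.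
Qed.

Lemma flow_fold_inv K (z : seq tree) st : flow_inv K st ->
  flow_inv K (foldl (fun st _ => flow_step s t st) st z).
Proof. by elim: z st => //= x z IH st /flow_step_inv/IH. Qed.

Definition fresh_res e : bool := [&& ~~ used e, oriented e & bval (rcost e) == w (o (aid e))].

Lemma flow_run_inv (K : seq tree) l : all fresh_res l ->
  (forall a, count (fun e => o (aid e) == a) l = cap a) ->
  flow_inv (size K) (flow_run s t K l) /\ flow_done (flow_run s t K l).
Proof.
move=> /allP Hf Hc; split.
  apply: flow_fold_inv; split=> //=.
  - by apply/allP => e /Hf/and3P[].
  - exists (fun=> 0); apply/allP => e /Hf/and3P[/negbTE h _ /eqP h'].
    by rewrite /priced h h' addr0 subr0.
  - move=> p; rewrite /excess big_nil add0r subrr mul0r big_seq_cond big1 // => e.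
    by case/andP=> /Hf/and3P[/negbTE->].
apply: flow_fold_done; rewrite size_unary_mul /flow_measure /=; nia.
Qed.

Lemma sum_by_arc l (P : pred res) (F : A -> int) :
  \sum_(e <- l | P e) F (o (aid e)) =
  \sum_a (count (fun e => (o (aid e) == a) && P e) l)%:Z * F a.
Proof.
elim: l => [|e l IH] /=; first by rewrite big_nil big1 // => a _; rewrite mul0r.
under [RHS]eq_bigr do rewrite PoszD mulrDl.
rewrite big_split /= -IH big_cons; case: (P e) => /=.
  congr (_ + _); under eq_bigr do rewrite andbT.
  rewrite (bigD1 (o (aid e))) //= eqxx mul1r big1 ?addr0 // => a.
  by rewrite eq_sym => /negbTE->; rewrite mul0r.
by rewrite [X in _ = X + _]big1 ?add0r // => a _; rewrite andbF mul0r.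
Qed.

Section Outcome.
Variables (K : nat) (st : state).
Hypothesis (I : flow_inv K st).
Let L := st.2.2.1 ++ st.2.2.2.

Definition used_count (a : A) : nat := count (fun e => (o (aid e) == a) && used e) L.

Lemma used_count_cap a : (used_count a <= cap a)%N.
Proof. by rewrite -(inv_count I); apply: sub_count => e /= /andP[]. Qed.

Lemma excess_used_count p :
  (K%:Z - (size st.1)%:Z) * (p t - p s) = \sum_a (used_count a)%:Z * (p (hd a) - p (tl a)).
Proof.
rewrite -(inv_excess I) /excess -big_cat -/L /used_count -sum_by_arc.
rewrite big_seq_cond [RHS]big_seq_cond; apply: eq_bigr => e /andP[eL ue].
by have := allP (inv_oriented I) e eL; rewrite /oriented ue => /and3P[/eqP-> /eqP->].
Qed.

Lemma outcome_flow : nilp st.1 -> is_flow used_count K.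
Proof. by move=> /nilP E p; rewrite -excess_used_count E subr0. Qed.

(* Complementary slackness: reduced costs are nonpositive on used arcs and
   nonnegative on arcs that are not saturated. *)
Lemma outcome_optimal (g : A -> nat) :
  nilp st.1 -> is_flow g K -> (forall a, (g a <= cap a)%N) ->
  (\sum_a used_count a * w a <= \sum_a g a * w a)%N.
Proof.
move=> n Hg Hcap; have [p /allP Hp] := inv_priced I.
have Ho := allP (inv_oriented I).
have key a : 0 <= ((g a)%:Z - (used_count a)%:Z) * ((w a)%:Z + p (tl a) - p (hd a)).
  have [lt|lt|->] := ltngtP (g a) (used_count a); last by rewrite subrr mul0r.
  - have /hasP[e eL /andP[/eqP ea ue]] : has (fun e => (o (aid e) == a) && used e) L.
      by rewrite has_count; apply: leq_ltn_trans lt.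
    have /eqP := Hp e eL; have := Ho e eL; rewrite /oriented ue ea => /and3P[/eqP-> /eqP-> _] E.
    apply: mulr_le0; lia.
  - have /hasP[e eL /andP[/eqP ea ue]] : has (fun e => (o (aid e) == a) && ~~ used e) L.
      rewrite has_count.
      have : (count (fun e => o (aid e) == a) L =
              used_count a + count (fun e => (o (aid e) == a) && ~~ used e) L)%N.
        by rewrite /used_count; elim: (L) => //= e l ->; case: eqP; case: used => //=; lia.
      by rewrite (inv_count I); have := Hcap a; lia.
    have /eqP := Hp e eL; have := Ho e eL.
    rewrite /oriented (negbTE ue) ea => /and3P[/eqP-> /eqP-> _] E.
    apply: mulr_ge0; lia.
have : 0 <= \sum_a ((g a)%:Z - (used_count a)%:Z) * ((w a)%:Z + p (tl a) - p (hd a)).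
  by apply: sumr_ge0 => a _; exact: key.
(* The potential part is the same for all flows of value [K], so it cancels and only the costs
   remain. *)
have -> : \sum_a ((g a)%:Z - (used_count a)%:Z) * ((w a)%:Z + p (tl a) - p (hd a)) =
  (\sum_a (g a)%:Z * (w a)%:Z - \sum_a (used_count a)%:Z * (w a)%:Z)
  - (\sum_a (g a)%:Z * (p (hd a) - p (tl a)) - \sum_a (used_count a)%:Z * (p (hd a) - p (tl a))).
  by rewrite -!sumrB; apply: eq_bigr => a _; ring.
rewrite Hg (outcome_flow n) subrr subr0.
have E (h : A -> nat) : \sum_a (h a)%:Z * (w a)%:Z = (\sum_a h a * w a)%N%:Z.
  by rewrite (big_morph _ PoszD (erefl 0%:Z)); apply: eq_bigr => a _; rewrite PoszM.
by rewrite !E subr_ge0 lez_nat.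
Qed.

(** No residual arc leaves the reached set, so arcs leaving it are saturated and arcs entering it
    are empty. For the potential 0 inside and 1 outside, the flow identity equates the cut capacity
    with the value sent, which is less than [K]. *)
Lemma outcome_cut : flow_done st -> ~~ nilp st.1 ->
  exists X : pred tree, [/\ X s, ~~ X t &
    (\sum_(a | X (tl a) && ~~ X (hd a)) cap a < K)%N].
Proof.
rewrite /flow_done => /orP[->//|/andP[tX /allP Hr]] n.
have /andP[/allP Hin sX] := search_tree_inside (inv_tree I).
pose X : pred tree := fun v => v \in st.2.1.
exists X; split=> //.
have Hcr e : e \in L -> ~~ cross st.2.1 e.
  rewrite mem_cat => /orP[/Hin/andP[h1 h2]|/Hr//].
  by rewrite /cross h2 andbF.
pose p v : int := if X v then 0 else 1.
have := excess_used_count p.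
have pt1 : p t = 1 by rewrite /p (negbTE tX : X t = false).
have ps0 : p s = 0 by rewrite /p (sX : X s).
rewrite pt1 ps0 subr0 mulr1.
have -> : \sum_a (used_count a)%:Z * (p (hd a) - p (tl a)) =
          (\sum_(a | X (tl a) && ~~ X (hd a)) cap a)%N%:Z.
  rewrite (big_morph _ PoszD (erefl 0%:Z)) [RHS]big_mkcond /=; apply: eq_bigr => a _.
  rewrite /p; case Xt: (X (tl a)); case Xh: (X (hd a)) => //=; rewrite ?subrr ?mulr0 //.
  - rewrite subr0 mulr1 -(inv_count I) /used_count; congr (_%:Z).
    apply: eq_in_count => e eL /=; case: eqP => //= ea.
    have := Hcr e eL; have := allP (inv_oriented I) e eL; rewrite /oriented ea.
    case: used => //= /and3P[/eqP h1 /eqP h2 _]; rewrite /cross h1 h2.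
    by rewrite (Xt : (_ \in _) = true) (Xh : (_ \in _) = false).
  - rewrite /used_count (_ : count _ _ = 0%N) ?mul0r //.
    apply/eqP; rewrite eqn0Ngt -has_count; apply/hasPn => e eL; apply/negP => /andP[/eqP ea ue].
    have := Hcr e eL; have := allP (inv_oriented I) e eL; rewrite /oriented ea ue.
    move=> /and3P[/eqP h1 /eqP h2 _]; rewrite /cross h1 h2.
    by rewrite (Xh : (_ \in _) = true) (Xt : (_ \in _) = false).
move=> E; have : (0 < size st.1)%N by case: (st.1) n.
by have := inv_size I; move: E; lia.
Qed.

End Outcome.

Lemma flow_crosses (X : pred tree) (g : A -> nat) K :
  is_flow g K -> X s -> ~~ X t ->
  (K <= \sum_(a | X (tl a) && ~~ X (hd a)) g a)%N.
Proof.
move=> Hg sX tX; pose p v : int := if X v then 0 else 1.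
have := Hg p; rewrite {3 4}/p sX (negbTE tX) subr0 mulr1 => E.
rewrite -lez_nat -E (big_morph _ PoszD (erefl 0%:Z)) [leRHS]big_mkcond /=.
apply: ler_sum => a _; rewrite /p; case: (X (tl a)); case: (X (hd a)) => //=; lia.
Qed.

End FlowCorrectness.

(** * Max-flow min-cut *)

Section MaxFlowMinCut.
Variables (A : finType) (name : A -> tree) (o : tree -> A) (tl hd : A -> tree).
Variables (s t : tree).
Hypothesis nameK : cancel name o.

(* The algorithm itself, run with zero weights, proves the theorem. *)
Lemma max_flow_min_cut (cap : A -> nat) (K : nat) :
  (exists2 g, is_flow tl hd s t g K & forall a, g a <= cap a) \/
  (exists X : pred tree, [/\ X s, ~~ X t &
     \sum_(a | X (tl a) && ~~ X (hd a)) cap a < K]).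
Proof.
pose mk a : res := (name a, (tl a, (hd a, ([::], false)))).
pose l := flatten [seq nseq (cap a) (mk a) | a <- enum A].
have Hf : all (fresh_res name o tl hd (fun=> 0)) l.
  apply/allP => e /flattenP[q /mapP[a _ ->] /nseqP[-> _]].
  by rewrite /fresh_res /oriented /mk /used /src /dst /aid /rcost /= nameK !eqxx.
have Hc a : count (fun e => o (aid e) == a) l = cap a.
  rewrite /l count_flatten -map_comp sumnE big_map big_enum /= (bigD1 a) //= count_nseq.
  rewrite /aid /= nameK eqxx mul1n big1 ?addn0 // => b /negbTE nb.
  by rewrite count_nseq /= nameK nb.
have [I D] := flow_run_inv s t (nseq K Leaf) Hf Hc; rewrite size_nseq in I.
case: (boolP (nilp (flow_run s t (nseq K Leaf) l).1)) => n; [left | right].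
  exists (used_count o (flow_run s t (nseq K Leaf) l)); first exact: outcome_flow I n.
  exact: used_count_cap I.
exact: outcome_cut I D n.
Qed.

End MaxFlowMinCut.

(** * Encodings *)

Fixpoint pos_bits (p : BinNums.positive) : seq bool :=
  match p with
  | BinNums.xH => [:: true]
  | BinNums.xO q => false :: pos_bits q
  | BinNums.xI q => true :: pos_bits q
  end.

Definition nat_bits (n : nat) : seq bool :=
  if bin_of_nat n is BinNums.Npos p then pos_bits p else [::].

Lemma nat_bitsK : cancel nat_bits bval.
Proof.
move=> n; rewrite -[RHS]bin_of_natK /nat_bits; case: bin_of_nat => //= p.
by elim: p => //= p ->; rewrite NatTrec.doubleE.
Qed.

Lemma enc_nat_bits n : enc (nat_bits n) = enc_nat n.
Proof.
rewrite /nat_bits /enc_nat; case: bin_of_nat => //= p.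
by elim: p => //= p <-.
Qed.

Lemma enc_nat_inj : injective enc_nat.
Proof.
pose fix tval d := if d is Node x r then is_node x + (tval r).*2 else 0.
have tvalE b : tval (enc b) = bval b.
  by elim: b => //= x b <-; case: x.
by apply: (can_inj (g := tval)) => n; rewrite -enc_nat_bits tvalE nat_bitsK.
Qed.

Lemma unary_inj : injective unary.
Proof.
move=> i j E; have : esize (unary i) = esize (unary j) by rewrite E.
by rewrite !esize_unary; lia.
Qed.

(** * Flows and disjoint paths *)

Section Paths.
Variable I : ftf_instance.
Implicit Types (x y : vertex I) (a f : darc I) (S : {set darc I}) (p : seq (darc I)).

Lemma diwalk_cross (X : pred (vertex I)) x p y : diwalk x p y -> X x -> ~~ X y ->
  exists2 a, a \in p & X (arc_tail a) && ~~ X (arc_head a).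
Proof.
elim: p x => [|a p IH] x /=; first by move=> /eqP-> ->.
case/andP=> /eqP <- W Xx Xy; case: (boolP (X (arc_head a))) => Xa.
  by have [b bp Xb] := IH _ W Xa Xy; exists b; rewrite // in_cons bp orbT.
by exists a; rewrite ?mem_head ?Xx.
Qed.

(** The easy half of Menger's theorem: each path crosses the cut, and disjointness makes the chosen
    arcs distinct. *)
Lemma disjoint_paths_cut (X : pred (vertex I)) k x y S :
  has_disjoint_paths k x y S -> X x -> ~~ X y ->
  k <= #|[set a in S | X (arc_tail a) && ~~ X (arc_head a)]|.
Proof.
move=> [P [HP Hd]] Xx Xy.
have /fin_all_exists[c Hc] i : exists a,
    (a \in P i) && (X (arc_tail a) && ~~ X (arc_head a)).
  have [/andP[W _] _] := HP i.
  by have [a aP Xa] := diwalk_cross W Xx Xy; exists a; rewrite aP.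
have cinj : injective c.
  move=> i j E; apply/eqP/negPn/negP => ne.
  have /andP[hi _] := Hc i; have /andP[hj _] := Hc j.
  by have := Hd i j ne (c i); rewrite hi E hj.
rewrite -[k in k <= _]card_ord -(card_imset predT cinj); apply: subset_leq_card.
apply/subsetP => a /imsetP[i _ ->]; have /andP[hi hX] := Hc i.
by rewrite inE hX andbT; have [_ sub] := HP i; exact: sub.
Qed.

Lemma has_disjoint_pathsW k x y S S' :
  S \subset S' -> has_disjoint_paths k x y S -> has_disjoint_paths k x y S'.
Proof.
move=> /subsetP sub [P [HP Hd]]; exists P; split=> // i.
by have [? s] := HP i; split=> // a /s/sub.
Qed.

Section Decomposition.
Local Open Scope ring_scope.

Lemma diwalk_sum (h : vertex I -> int) x p y : diwalk x p y ->
  \sum_(a <- p) (h (arc_head a) - h (arc_tail a)) = h y - h x.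
Proof.
elim: p x => [|a p IH] x /=; first by move/eqP->; rewrite big_nil subrr.
by case/andP=> /eqP <- /IH; rewrite big_cons => ->; lia.
Qed.

Lemma connect_dipath S x y :
  connect [rel u v | [exists a in S, (arc_tail a == u) && (arc_head a == v)]] x y ->
  exists2 p, dipath x p y & {subset p <= S}.
Proof.
case/connectP=> q0 /shortenP[q Hq uq _ ->] {q0}.
suff [p [W E sub]] : exists p, [/\ diwalk x p (last x q),
    [seq arc_head a | a <- p] = q & {subset p <= S}].
  by exists p => //; rewrite /dipath W E.
elim: q x Hq {uq} => [|v q IH] x /=.
  by move=> _; exists [::]; split=> /=.
case/andP=> /existsP[a /and3P[aS /eqP ta /eqP ha]] /IH[p [W E sub]].
exists (a :: p); split=> /=; rewrite ?ta ?eqxx ?ha ?E //.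
by move=> b; rewrite in_cons => /orP[/eqP->|/sub].
Qed.

(** By telescoping, removing one path lowers the value by one; leftover cycles do no harm. A path
    exists because the potential that is 0 exactly on the vertices reachable from [x] would
    otherwise make the left side nonpositive and the right side positive. *)
Lemma flow_disjoint_paths k x y S :
  (forall h : vertex I -> int,
     \sum_(a in S) (h (arc_head a) - h (arc_tail a)) = k%:Z * (h y - h x)) ->
  has_disjoint_paths k x y S.
Proof.
elim: k S => [|k IH] S Hh.
  by exists (fun=> [::]); split=> [[]|[]].
pose r := [rel u v | [exists a in S, (arc_tail a == u) && (arc_head a == v)]].
have Hxy : connect r x y.
  apply/negPn/negP => nc; pose h v : int := if connect r x v then 0 else 1.
  have := Hh h; rewrite /h connect0 (negbTE nc) subr0 mulr1 => E.
  have : \sum_(a in S) (h (arc_head a) - h (arc_tail a)) <= 0.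
    apply: sumr_le0 => a aS; rewrite /h; case: ifP => // nh; case: ifP => // ct.
    case/negP: nh; apply: connect_trans ct (connect1 _) => /=.
    by apply/existsP; exists a; rewrite aS !eqxx.
  by rewrite E.
have [p Hp sub] := connect_dipath Hxy.
have /andP[W /=/andP[_ /map_uniq up]] := Hp.
have [|P [HP Hd]] := IH (S :\: [set a in p]).
  move=> h; have := Hh h; rewrite (big_setID [set a in p]) /=.
  have -> : S :&: [set a in p] = [set a in p].
    by apply/setIidPr/subsetP => a; rewrite inE => /sub.
  under eq_bigl do rewrite inE.
  rewrite -(big_uniq _ up) /= (diwalk_sum h W) => E.
  by apply: (addrI (h y - h x)); rewrite E -addn1 PoszD; ring.
exists (fun i => if unlift ord0 i is Some j then P j else p); split.
  move=> i; case: unliftP => [j _|_]; last by [].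
  have [? s] := HP j; split=> // a /s; by rewrite inE => /andP[].
move=> i j; case: (unliftP ord0 i) => [i' ->|->]; case: (unliftP ord0 j) => [j' ->|->].
- by rewrite (inj_eq lift_inj) => /Hd.
- by move=> _ a; apply/negP => /andP[/(proj2 (HP i'))]; rewrite !inE => /andP[/negbTE->].
- by move=> _ a; apply/negP => /andP[ap /(proj2 (HP j'))]; rewrite !inE ap.
- by rewrite eqxx.
Qed.

End Decomposition.

Definition tail_name a : tree := enc_nat (arc_tail a).
Definition head_name a : tree := enc_nat (arc_head a).
Definition arc_name a : tree := unary a.
Definition name_arc (a0 : darc I) (d : tree) : darc I :=
  odflt a0 [pick a | arc_name a == d].

Lemma arc_nameK a0 : cancel arc_name (name_arc a0).
Proof.
move=> a; rewrite /name_arc; case: pickP => [b /eqP/unary_inj/val_inj//|/(_ a)].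
by rewrite eqxx.
Qed.

Definition capacity a : nat := if a \in vulnerable I then ell I else (ell I).+1.
Notation flow := (is_flow tail_name head_name (enc_nat (source I)) (enc_nat (target I))).

Lemma ell_gt0 : 0 < ell I. Proof. exact: ell_ge1. Qed.

(* A cut of [S :\ f] with fewer than [ell] arcs, together with [f], has
   capacity at most [(ell - 1) * (ell + 1) + ell]. *)
Lemma support_feasible (g : darc I -> nat) :
  flow g (ell I * (ell I).+1) -> (forall a, g a <= capacity a) ->
  feasible [set a | 0 < g a].
Proof.
move=> Hg Hc f fM; set B := [set a | _].
have := max_flow_min_cut tail_name head_name (enc_nat (source I)) (enc_nat (target I))
  (arc_nameK f) (fun a => (a \in B :\ f) : nat) (ell I).
case=> [[h Hh hc]|[X [sX tX lt]]].
  apply: (has_disjoint_pathsW (S := [set a | 0 < h a])).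
    by apply/subsetP => a; rewrite inE; have := hc a; case: (a \in B :\ f); lia.
  apply: flow_disjoint_paths => p.
  (* Flows are tested by potentials on trees, so [p] is extended along the injective [enc_nat]. *)
  have decK : exists q : tree -> int, forall x, q (enc_nat x) = p x.
    exists (fun d => if [pick x : vertex I | enc_nat x == d] is Some x then p x else 0%R).
    move=> x; case: pickP => [y /eqP/enc_nat_inj/val_inj->//|/(_ x)].
    by rewrite eqxx.
  have [q Hq] := decK; have := Hh q; rewrite !Hq => <-.
  rewrite big_mkcond /=; apply: eq_bigr => a _; rewrite !Hq inE.
  have : h a <= 1 by apply: leq_trans (hc a) _; case: (_ \in _).
  by case: (h a) => [|[|]] //=; rewrite ?mul0r ?mul1r.
pose O a := X (tail_name a) && ~~ X (head_name a).
have cr : ell I * (ell I).+1 <= \sum_(a | O a) g a := flow_crosses Hg sX tX.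
have {}lt : \sum_(a | O a) (a \in B :\ f) < ell I := lt.
(* [g] vanishes outside [B], and at the vulnerable [f] it is at most [ell]. *)
have : \sum_(a | O a) g a <= \sum_(a | O a) ((ell I).+1 * (a \in B :\ f) + ell I * (a == f)).
  apply: leq_sum => a _; rewrite !inE; have := Hc a; rewrite /capacity.
  case: eqP => [->|_] /=; first by rewrite fM; lia.
  by case: (g a) => // n; case: ifP => _; lia.
rewrite big_split /= -!big_distrr /=.
have : \sum_(a | O a) (a == f) <= 1.
  rewrite big_mkcond (bigD1 f) //= big1 ?addn0; last by move=> a /negbTE->; case: ifP.
  by rewrite eqxx; case: ifP.
move: ell_gt0 lt cr; move: (\sum_(a | O a) g a) (\sum_(a | O a) (a \in _)) => G N.
move: (\sum_(a | O a) (a == f)) (ell I) => z n; clear => n0 lt cr z1 le.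
have : n.+1 * N <= n.+1 * n.-1 by rewrite leq_mul2l /=; lia.
have : n * z <= n * 1 by rewrite leq_mul2l z1 orbT.
by case: n n0 lt cr le => // n; nia.
Qed.

Lemma feasible_flow S f0 :
  f0 \in vulnerable I -> source I != target I -> feasible S ->
  exists2 g, flow g (ell I * (ell I).+1) & forall a, g a <= (a \in S) * capacity a.
Proof.
move=> f0M ne F.
have := max_flow_min_cut tail_name head_name (enc_nat (source I)) (enc_nat (target I))
  (arc_nameK f0) (fun a => (a \in S) * capacity a) (ell I * (ell I).+1).
case=> // -[X [sX tX lt]]; exfalso.
pose O a := X (tail_name a) && ~~ X (head_name a).
pose D := [set a in S | O a].
have HD f : f \in vulnerable I -> ell I <= #|D :\ f|.
  move=> fM; have := disjoint_paths_cut (X := fun x : vertex I => X (enc_nat x)) (F f fM) sX tX.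
  congr (_ <= _); apply: eq_card => a.
  by rewrite !inE -andbA.
have sumE : \sum_(a | O a) (a \in S) * capacity a = \sum_(a in D) capacity a.
  rewrite [RHS]big_mkcond [LHS]big_mkcond; apply: eq_bigr => a _; rewrite inE.
  by case: (O a); rewrite ?andbF ?andbT //; case: (a \in S); rewrite ?mul1n ?mul0n.
have {}lt : \sum_(a in D) capacity a < ell I * (ell I).+1 by rewrite -sumE.
(* If the cut has a vulnerable arc, [ell] others remain when it fails: [ell + 1] arcs of capacity at
   least [ell]. *)
case: (pickP (fun a => (a \in D) && (a \in vulnerable I))) => [f /andP[fD fM]|no].
  have hD := HD f fM.
  have le : #|D| * ell I <= \sum_(a in D) capacity a.
    by rewrite -sum_nat_const; apply: leq_sum => a _; rewrite /capacity; case: ifP.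
  have : (ell I).+1 * ell I <= #|D| * ell I.
    by rewrite leq_mul2r (cardsD1 f D) fD add1n ltnS hD orbT.
  by rewrite mulnC; lia.
(* A cut of safe arcs only: the failure of [f0] still yields [ell] of them, of capacity [ell + 1]
   each. *)
have hD := leq_trans (HD f0 f0M) (subset_leq_card (subD1set D f0)).
have le : #|D| * (ell I).+1 <= \sum_(a in D) capacity a.
  rewrite -sum_nat_const; apply: leq_sum => a aD; rewrite /capacity.
  by have := no a; rewrite aD /= => ->.
have : ell I * (ell I).+1 <= #|D| * (ell I).+1 by rewrite leq_mul2r hD orbT.
by lia.
Qed.

End Paths.

(** * The approximation guarantee *)

Lemma to_unaryE b (l : seq raw_arc) :
  bval (to_unary b l).1 = bval b - size l /\ size (to_unary b l).2 = minn (bval b) (size l).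
Proof.
rewrite /to_unary.
suff H z : bval (foldl (fun z _ => unary_step z) z l).1 = bval z.1 - size l /\
    size (foldl (fun z _ => unary_step z) z l).2 = size z.2 + minn (bval z.1) (size l).
  exact: H.
elim: l z => [|e l IH] z /=; first by rewrite subn0 minn0 addn0.
have [-> ->] := IH (unary_step z); rewrite /unary_step.
have := bval_eq0 z.1; case: ifP => h /= hz; last by lia.
by rewrite bsubE /=; lia.
Qed.

Lemma copies_all (p : pred res) (u : seq tree) l :
  all (fun a => p (new_res l a)) l -> all p (copies u l).
Proof.
rewrite /copies -(all_map (fun a => (new_res l a, a.2.2.2.2.1)) (fun r => p r.1)).
have : all p [::] by []; elim: (map _ l) [::] => //= r q IH acc pa /andP[pr pq].
by apply: IH => //; rewrite push_nseq all_cat all_nseq pr pa orbT.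
Qed.

Lemma copies_count (p : pred res) (u : seq tree) l :
  count p (copies u l) =
  \sum_(a <- l) p (new_res l a) * (if a.2.2.2.2.1 then size u else (size u).+1).
Proof.
rewrite /copies -[RHS]addn0 -[X in _ + X]/(count p [::]).
rewrite -(big_map (fun a => (new_res l a, a.2.2.2.2.1)) xpredT
  (fun r => p r.1 * (if r.2 then size u else (size u).+1))).
elim: (map _ l) [::] => [|r q IH] acc /=; first by rewrite big_nil.
rewrite IH big_cons push_nseq count_cat count_nseq.
by case: (r.2) => /=; lia.
Qed.

Section Instance.
Variable I : ftf_instance.
Notation A := (darc I).
Implicit Types (a b : A) (S : {set A}).

Definition raw a : raw_arc :=
  (tail_name a, (head_name a,
    ((nat_bits `|numq (weight a)|, nat_bits `|denq (weight a)|),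
     (a \in vulnerable I, Leaf)))).

Definition ftf_input : input :=
  (enc_seq [seq enc_nat x | x : vertex I <- enum 'I_(nvert I)],
   ([seq raw a | a <- enum 'I_(narc I)],
    (enc_nat (source I), (enc_nat (target I), (nat_bits (ell I), Leaf))))).

Lemma enc_ftf_input : enc ftf_input = enc_instance I.
Proof.
have E : [seq enc i | i <- [seq raw a | a <- enum 'I_(narc I)]] =
         [seq enc_arc a | a <- enum 'I_(narc I)].
  rewrite -map_comp; apply: eq_map => a /=.
  by rewrite /enc_arc /enc_rat -(enc_nat_bits `|numq _|) -(enc_nat_bits `|denq _|).
by rewrite /enc_instance -E -(enc_nat_bits (ell I)).
Qed.

Definition named : seq (tree * raw_arc) := [seq (arc_name a, raw a) | a <- enum 'I_(narc I)].

Lemma enumerate_input : enumerate [seq raw a | a <- enum 'I_(narc I)] = named.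
Proof.
rewrite enumerateE size_map size_enum_ord -val_enum_ord -map_comp /named.
by elim: (enum _) => //= a l ->.
Qed.

Definition den a : nat := `|denq (weight a)|.

Definition int_weight a : nat := `|numq (weight a)| * \prod_(b | b != a) den b.

Lemma scaleE a : bval (scale named (arc_name a, raw a)) = int_weight a.
Proof.
have E : \prod_(b | b != a) den b = \prod_(b <- enum A | b != a) den b.
  by rewrite big_enum_cond /=; apply: eq_bigl => b.
rewrite /scale /named /int_weight /= -[in RHS](nat_bitsK `|numq (weight a)|) {}E.
elim: (enum _) (nat_bits _) => [|b l IH] acc /=; first by rewrite big_nil muln1.
rewrite IH big_cons; case: eqP => [/unary_inj/val_inj->|ne]; first by rewrite eqxx.
case: eqP => [E|_]; first by case: ne; rewrite E.
by rewrite bmulE nat_bitsK -mulnA mulnCA.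
Qed.

Section RatWeights.
Local Open Scope ring_scope.

(** The factor does not depend on [a], so comparisons between total weights are unaffected. *)
Lemma int_weightE a : (int_weight a)%:R = weight a * (\prod_b den b)%N%:R :> rat.
Proof.
have dE b : (den b)%:R = (denq (weight b))%:~R :> rat.
  by rewrite pmulrn /den absz_denq.
have nE : (`|numq (weight a)|%N)%:R = (numq (weight a))%:~R :> rat.
  by rewrite pmulrn gez0_abs // numq_ge0 weight_ge0.
have -> : (\prod_b den b = den a * \prod_(b | b != a) den b)%N by rewrite (bigD1 a).
rewrite /int_weight !natrM nE dE mulrA -{2}(divq_num_den (weight a)).
by rewrite divfK // intr_eq0 denq_neq0.
Qed.

Lemma prod_den_gt0 : 0 < (\prod_b den b)%N%:R :> rat.
Proof.
rewrite ltr0n prodn_gt0 // => b; rewrite /den absz_gt0; exact: denq_neq0.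
Qed.

Lemma total_weight_scaled S :
  total_weight S * (\prod_b den b)%N%:R = (\sum_(a in S) int_weight a)%N%:R.
Proof.
by rewrite /total_weight mulr_suml natr_sum; apply: eq_bigr => a _; rewrite int_weightE.
Qed.

End RatWeights.

(** Exact length is what makes the output equal, as a tree, to the characteristic vector of the set
    read from it. *)
Lemma size_ftf_alg bs : ftf_alg ftf_input = Some bs -> size bs = narc I.
Proof.
rewrite /ftf_alg; case: ifP => _; first by case=> <-; rewrite size_map /= size_map size_enum_ord.
case: ifP => // _; rewrite /ftf_flow; case: ifP => // _ [<-].
by rewrite size_map enumerate_input size_map size_enum_ord.
Qed.

Definition ftf_solve : option {set A} :=
  omap (fun bs => [set a : A | nth false bs a]) (ftf_alg ftf_input).

Lemma enc_ftf_solve : enc_solution ftf_solve = enc (ftf_alg ftf_input).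
Proof.
rewrite /ftf_solve; case E: ftf_alg => [bs|] //=; congr (Node _ _).
rewrite /enc /enc_list; congr enc_seq.
rewrite -[in RHS](mkseq_nth false bs) (size_ftf_alg E) /mkseq -val_enum_ord -!map_comp.
by apply: eq_map => a /=; rewrite inE.
Qed.

Lemma ftf_flowP (u : seq tree) (a0 : A) :
  size u = ell I -> source I != target I -> a0 \in vulnerable I ->
  match ftf_flow (enc_nat (source I)) (enc_nat (target I)) u named with
  | Some bs => exists g : A -> nat,
      [/\ is_flow (@tail_name I) (@head_name I) (enc_nat (source I)) (enc_nat (target I)) g
            (ell I * (ell I).+1),
          forall a, g a <= capacity a,
          forall h : A -> nat,
            is_flow (@tail_name I) (@head_name I) (enc_nat (source I))
              (enc_nat (target I)) h (ell I * (ell I).+1) ->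
            (forall a, h a <= capacity a) ->
            \sum_a g a * int_weight a <= \sum_a h a * int_weight a
        & forall a : A, nth false bs a = (0 < g a)]
  | None => forall S, ~ feasible S
  end.
Proof.
move=> su ne a0M; rewrite /ftf_flow.
set K := unary_mul _ _; set C := copies _ _.
have Hf : all (fresh_res (@arc_name I) (name_arc a0) (@tail_name I) (@head_name I) int_weight) C.
  apply: copies_all; rewrite {2}/named all_map; apply/allP => a _ /=.
  rewrite /fresh_res /oriented /new_res /used /src /dst /aid /rcost /= arc_nameK !eqxx /=.
  by rewrite scaleE.
have Hc a : count (fun e => name_arc a0 (aid e) == a) C = capacity a.
  rewrite copies_count {2}/named big_map big_enum /= (bigD1 a) //= /aid /= arc_nameK eqxx.
  rewrite mul1n big1 ?addn0; last by move=> b /negbTE nb; rewrite arc_nameK nb.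
  by rewrite su.
have [J D] := flow_run_inv (enc_nat (source I)) (enc_nat (target I)) K Hf Hc.
have sK : size K = ell I * (ell I).+1 by rewrite size_unary_mul /= su.
rewrite {}sK in J; set fin := flow_run _ _ _ _ in J D *.
case: ifPn => n.
  exists (used_count (name_arc a0) fin); split.
  - exact: outcome_flow J n.
  - exact: used_count_cap J.
  - by move=> h Hh hc; apply: (outcome_optimal J n Hh hc).
  have sz : size named = narc I by rewrite size_map size_enum_ord.
  move=> a; rewrite (nth_map (arc_name a, raw a)) ?sz //.
  rewrite /named (nth_map a) ?size_enum_ord // nth_ord_enum /= -has_cat /used_count -has_count.
  apply: eq_in_has => e eL.
  have /and3P[_ _ /eqP Ee] := allP (inv_oriented J) e eL.
  by rewrite {1}Ee (inj_eq (can_inj (arc_nameK a0))).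
(* A feasible set would send the full value across a cut of smaller capacity. *)
move=> S HS; have [X [sX tX lt]] := outcome_cut J D n.
have [g Hg gc] := feasible_flow a0M ne HS.
suff : ell I * (ell I).+1 < ell I * (ell I).+1 by rewrite ltnn.
apply: leq_ltn_trans (flow_crosses Hg sX tX) (leq_ltn_trans _ lt); apply: leq_sum => a _.
by apply: leq_trans (gc a) _; case: (_ \in _); rewrite ?mul1n.
Qed.

Lemma ftf_solveP :
  match ftf_solve with
  | Some B => feasible B /\ forall S, feasible S ->
      (total_weight B <= ((ell I)%:R + 1) * total_weight S)%R
  | None => forall S, ~ feasible S
  end.
Proof.
rewrite /ftf_solve /ftf_alg /= has_map /=.
have w0 S : (0 <= total_weight S)%R by apply: sumr_ge0 => a _; exact: weight_ge0.
case: ifPn => [triv|] /=.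
  set B := finset _; have -> : B = set0.
    apply/setP => a; rewrite !inE -map_comp.
    by rewrite (nth_map a) ?size_enum_ord.
  split; last first.
    move=> S _; rewrite /total_weight big_set0 mulr_ge0 // ?addr_ge0 ?ler0n //.
    exact: w0.
  move=> f fM; case/orP: triv => [/eqP/enc_nat_inj/val_inj E|/hasPn/(_ f)].
    exists (fun=> [::]); split=> // i; split=> //.
    by rewrite /dipath /= E eqxx.
  by rewrite mem_enum /= fM => /(_ isT).
rewrite negb_or negbK => /andP[ne /hasP[a0 _ /= a0M]].
have {}ne : source I != target I by apply: contraNneq ne => ->.
set q := to_unary _ _.
have [q1 q2] := to_unaryE (nat_bits (ell I)) [seq raw a | a <- enum 'I_(narc I)].
rewrite -/q nat_bitsK size_map size_enum_ord in q1 q2.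
case: ifPn => hq /=.
  move=> S HS; have le : narc I < ell I.
    by have := bval_eq0 q.1; rewrite hq q1 /=; lia.
  (* The cut around the source alone needs [ell] arcs, more than there are. *)
  have := disjoint_paths_cut (X := pred1 (source I)) (HS a0 a0M) (eqxx _).
  rewrite /= eq_sym ne => /(_ isT) H.
  have := leq_trans H (max_card _); rewrite card_ord; lia.
have sq : size q.2 = ell I.
  have := bval_eq0 q.1; rewrite (negbTE hq) q1 q2 /=; lia.
rewrite enumerate_input.
have := ftf_flowP sq ne a0M; case: ftf_flow => [bs|] //= [g [Hg gc gopt gB]].
set B := finset _; have EB : B = [set a | 0 < g a].
  by apply/setP => a; rewrite !inE gB.
rewrite EB; split; first exact: support_feasible.
move=> S HS; have [h Hh hc] := feasible_flow a0M ne HS.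
(* Clearing the common denominator turns the claim into one about integral costs. *)
rewrite -(ler_pM2r prod_den_gt0) -mulrA !total_weight_scaled natr1 -natrM ler_nat.
have hc' a : h a <= capacity a.
  by apply: leq_trans (hc a) _; case: (_ \in _); rewrite ?mul1n.
apply: leq_trans (leq_trans _ (gopt h Hh hc')) _.
  rewrite big_mkcond /=; apply: leq_sum => a _; rewrite inE.
  by case: (g a) => //= n; rewrite leq_pmull.
rewrite big_distrr [leqRHS]big_mkcond /=; apply: leq_sum => a _.
have := hc a; case: (a \in S) => /=; rewrite ?mul0n ?mul1n.
  rewrite leq_mul2r => le; apply/orP; right; apply: leq_trans le _.
  by rewrite /capacity; case: ifP.
by rewrite leqn0 => /eqP->.
Qed.

End Instance.

Local Open Scope ring_scope.

Theorem theorem17 :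
  exists alg : forall I : ftf_instance, option {set darc I},
    polytime enc_instance enc_solution alg /\
    approximates (fun I => (ell I)%:R + 1) alg.
Proof.
exists ftf_solve; split; last exact: ftf_solveP.
have [[C [T [[e HT] HC]]] _] := pt_ftf_alg.
(* [runs] uses variable 0 for input and output; the polynomial is the bound in [pb]. *)
exists (C 0%N), (('X + 2%:P) ^+ e) => I.
have [k [st [X E _ le]]] := HC 0%N (upd (fun=> Leaf) 0 (enc_instance I)) (ftf_input I)
  (etrans (upd_eq _ _ _) (esym (enc_ftf_input I))).
exists k; first by exists st => //; rewrite E enc_ftf_solve.
apply: leq_trans le (leq_trans (HT _) _).
by rewrite /esize enc_ftf_input horner_exp hornerD hornerX hornerC natrXE.
Qed.
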